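(* Let $X$ be an Asplund Banach space with the Radon–Nikodym property and let $\Omega\subset X$ be a convex domain, with quasihyperbolic metric $k=k_\Omega$. Then the function $(x,y)\mapsto k(x,y)$ is Fréchet differentiable at every point of some dense $G_\delta$ subset of $\Omega\times\Omega$. Moreover, for each fixed $x_0\in\Omega$, the function $k_{x_0}(y):=k(x_0,y)$ is Fréchet differentiable at every point of some dense $G_\delta$ subset of $\Omega$.
   Context: Banach spaces are real. A domain $\Omega\subset X$ is an open path-connected subset with non-empty boundary $\partial\Omega$. Write $d(z,\partial\Omega)$ for the norm distance from $z$ to $\partial\Omega$. The quasihyperbolic metric on $\Omega$ is $$k_\Omega(x,y)=\inf_\gamma\int_\gamma\frac{\|dz\|}{d(z,\partial\Omega)},$$ the infimum being over all rectifiable curves $\gamma$ in $\Omega$ joining $x$ and $y$. A Banach space $X$ is an Asplund space if each continuous convex function $f\colon X\to\mathbb R$ is Fréchet differentiable at every point of a dense $G_\delta$ subset of $X$. $X$ has the Radon–Nikodym property if each Lipschitz path $\gamma\colon[0,1]\to X$ is a.e. differentiable and $\gamma(t)=\gamma(0)+\int_0^t\gamma'(s)\,ds$ (Bochner integral) for all $t\in[0,1]$. *)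

(* Defs.v *)
From mathcomp Require Export all_boot all_order all_algebra.
From mathcomp Require Export all_classical all_reals all_analysis.
From mathcomp Require Export borel_hierarchy.
Export Order.TTheory GRing.Theory Num.Theory.
Export numFieldNormedType.Exports.

Set Implicit Arguments.
Unset Strict Implicit.
Unset Printing Implicit Defensive.

Local Open Scope classical_set_scope.
Local Open Scope ring_scope.

(** Relative notion: [D] is the trace on [A] of a G-delta set of the ambient
    space, and is dense in [A]. *)
Definition dense_Gdelta_in {T : topologicalType} (A D : set T) : Prop :=
  (exists2 G : set T, Gdelta G & D = A `&` G) /\ A `<=` closure D.

Definition asplund {R : realType} (X : completeNormedModType R) : Prop :=
  forall f : X -> R^o, continuous f -> convex_function setT f ->
  exists2 D : set X, Gdelta D /\ dense D & forall x, D x -> differentiable f x.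

Section bochner.
Context {d : measure_display} {T : measurableType d} {R : realType}
        {X : completeNormedModType R}.
Implicit Types (mu : {measure set T -> \bar R}) (D : set T) (s g : T -> X).

Definition simple_vfun mu D s : Prop :=
  [/\ finite_set (range s),
      forall x, measurable (s @^-1` [set x])
    & forall x, x != 0 -> (mu (D `&` s @^-1` [set x]) < +oo)%E].

Definition simple_vintegral mu D s : X :=
  \sum_(x \in range s) fine (mu (D `&` s @^-1` [set x])) *: x.

(** [g] is Bochner integrable on [D], with integral [I]. *)
Definition is_bochner_integral mu D g (I : X) : Prop :=
  exists s_ : nat -> T -> X,
    [/\ forall n, simple_vfun mu D (s_ n),
        {ae mu, forall t, D t -> s_ ^~ t @ \oo --> g t},
        (\int[mu]_(t in D) (`|g t - s_ n t|)%:E)%E @[n --> \oo] --> 0%E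
      & simple_vintegral mu D (s_ n) @[n --> \oo] --> I].

End bochner.

(** Paths and curves are total functions [R -> X] of which only the restriction
    to [[0, 1]] matters.  In particular the value of the derivative at the two
    end points is irrelevant below, these forming a null set. *)

Definition radon_nikodym_property {R : realType}
    (X : completeNormedModType R) : Prop :=
  forall gam : R^o -> X, [lipschitz gam t | t in `[0, 1]%classic] ->
    {ae lebesgue_measure, forall t : R, `[0, 1]%classic t -> derivable gam t 1}
    /\ forall t : R, `[0, 1]%classic t ->
         exists2 I : X,
           is_bochner_integral lebesgue_measure `[0, t]%classic (derive1 gam) I
         & gam t = gam 0 + I.

Section curves.
Context {R : realType} {X : completeNormedModType R}.
Implicit Types (gam : R -> X) (Omega : set X).

Definition curve_in Omega (x y : X) gam : Prop :=
  [/\ {within `[0, 1], continuous gam}, gam @` `[0, 1] `<=` Omega,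
      gam 0 = x & gam 1 = y].

Definition path_connected Omega : Prop :=
  forall x y, Omega x -> Omega y -> exists gam, curve_in Omega x y gam.

Definition boundary Omega : set X := closure Omega `\` interior Omega.

Definition domain Omega : Prop :=
  [/\ open Omega, path_connected Omega & boundary Omega !=set0].

Definition boundary_dist Omega (z : X) : R :=
  inf [set `|z - a| | a in boundary Omega].

(** Vector-valued analogues of [variation] and [total_variation]. *)
Definition polygonal_length gam (a b : R) (s : seq R) : R :=
  \sum_(0 <= i < size s)
    `|gam (nth b (a :: s) i.+1) - gam (nth b (a :: s) i)|.

Definition curve_length gam (a b : R) : \bar R :=
  ereal_sup [set (polygonal_length gam a b s)%:E | s in itv_partition a b].

Definition rectifiable gam : Prop :=
  {within `[0, 1], continuous gam} /\ (curve_length gam 0 1 < +oo)%E.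

(** Parametrization by arc length, on [[0, L]] with [L] the length of [gam].
    The choice of [t] is immaterial: [gam] is constant between two parameters
    at which the arc length is the same. *)
Definition arc_length_param gam (s : R) : X :=
  gam (xget 0 [set t | `[0, 1]%classic t /\ curve_length gam 0 t = s%:E]).

(** Integral of [f] along [gam] with respect to arc length. *)
Definition line_integral gam (f : X -> R) : \bar R :=
  (\int[lebesgue_measure]_(s in `[0%R, fine (curve_length gam 0 1)]%classic)
     (f (arc_length_param gam s))%:E)%E.

Definition quasihyperbolic Omega (x y : X) : R :=
  fine (ereal_inf
    [set line_integral gam (fun z => (boundary_dist Omega z)^-1)
    | gam in [set gam | rectifiable gam /\ curve_in Omega x y gam]]).

End curves.

(* Main.v *)
From HB Require Import structures.
Require Import Defs.
From mathcomp Require Import measurable_realfun ring lra.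

(** Let [d] be the distance to the boundary and [k] the quasihyperbolic
    distance.  The theorem follows from two facts: on a convex domain
    [k] is semiconvex, that is, locally on [Omega `*` Omega]
<<
      k ((1 - s) p0 + s p1)
        <= (1 - s) k p0 + s k p1 + C s (1 - s) |p0 - p1|^2,
>>
    and locally Lipschitz semiconvex functions are Frechet differentiable at the
    points of a dense G-delta set as soon as convex continuous ones are.

    Semiconvexity ([quasihyperbolic_locally_semiconvex]) comes from the
    concavity of [d].  Curves are first replaced by chains, finite sequences of
    points of [Omega] with [`|z i.+1 - z i| <= r * d (z i)]; the distance [k x y]
    is the limit of [r] times the least number of steps of a chain from [x] to
    [y] ([chain_of_quasihyperbolic], [quasihyperbolic_le_chain]).  By concavity
    of [d] the average of two chains of ratio [r] is a chain of ratio [r], which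
    makes [k] quasiconvex.  To gain true convexity up to second order, let the
    shorter of two chains stand still at its end while the longer one goes on.
    During that last part the average of weights [1 - s] and [s] moves at
    [1 - s] times the speed of the longer chain, so that the numbers of steps
    combine convexly.  The deviation comes from the variation of [d] along the
    last part, whose length is the difference of the two distances, hence
    [O(|p0 - p1|)]; the variation is of the same order, and the product of the two
    is quadratic.

    For differentiability ([generic_frechet]), a semiconvex function has
    one-sided directional derivatives that are sublinear in the direction and
    upper semicontinuous in the point.  The supremum of these derivatives over
    an open set [U] is a continuous convex function of the direction.  Where it
    is Frechet differentiable, the points of [U] whose derivatives nearly attain
    the supremum have derivatives close to each other; moving a little in the
    direction considered, one finds an open subset of [U] on which the
    derivatives oscillate little ([small_oscillation]).  Baire's theorem then
    yields a dense G-delta set of points at which the oscillation vanishes, and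
    there the function is Frechet differentiable ([frechet_of_osc]).  For a
    function on [X * X] the directions are taken in one factor at a time. *)

Set Implicit Arguments.
Unset Strict Implicit.
Unset Printing Implicit Defensive.

Local Open Scope classical_set_scope.
Local Open Scope ring_scope.

(** * Semiconvex functions and their one-sided derivatives *)

Section semiconvex.
Context {R : realType} {Y : normedModType R}.
Implicit Types (f : Y -> R) (B U V : set Y) (C K s t c e d : R) (y v w : Y).

Definition semiconvex_on B C f := forall a b s, B a -> B b -> 0 <= s <= 1 ->
  f ((1 - s) *: a + s *: b) <=
    (1 - s) * f a + s * f b + C * (s * (1 - s) * `|a - b| ^+ 2).

Definition lipschitz_bound B K f :=
  forall a b, B a -> B b -> `|f a - f b| <= K * `|a - b|.

Definition dquot f y v t := (f (y + t *: v) - f y) / t.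

(** The one-sided directional derivative.  On a semiconvex function the
    corrected quotient is nondecreasing in [t], so that its infimum is its
    limit at [0]; as an infimum it is bounded by each single quotient, which
    makes the derivative upper semicontinuous in [y]. *)
Definition ddir B C f y v :=
  inf [set dquot f y v t + C * t * `|v| ^+ 2 |
       t in [set t | 0 < t /\ B (y + t *: v)]].

(** The form in which every estimate below passes to the limit: the slack [e]
    is arbitrary, and the linear term vanishes with the step [t]. *)
Lemma le_of_small_slack (a b M : R) : 0 <= M ->
  (forall e, 0 < e -> exists2 t0, 0 < t0 &
     forall t, 0 < t < t0 -> a <= b + e + M * t) -> a <= b.
Proof.
move=> M0 H; apply/ler_addgt0Pr => e e0.
have [t0 t00 Ht] := H (e / 2) ltac:(lra).
have M1 : 0 < M + 1 by lra.
pose t := Num.min (t0 / 2) (e / 2 / (M + 1)).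
have tp : 0 < t by rewrite lt_min !divr_gt0.
have tt0 : t <= t0 / 2 by rewrite ge_min lexx.
have : t <= e / 2 / (M + 1) by rewrite ge_min lexx orbT.
rewrite ler_pdivlMr// => te.
have := Ht t ltac:(lra); nra.
Qed.

Lemma open_segment B y v : open B -> B y ->
  exists2 e, 0 < e & forall t, 0 <= t < e -> B (y + t *: v).
Proof.
move=> oB By.
have /nbhs_ballP[r /= r0 rB] : nbhs y B by exact: open_nbhs_nbhs.
have v1 : 0 < `|v| + 1 by rewrite ltr_wpDl.
exists (r / (`|v| + 1)); first by rewrite divr_gt0.
move=> t /andP[t0 tr]; apply: rB; rewrite -ball_normE /ball_ /=.
rewrite opprD addrA subrr sub0r normrN normrZ ger0_norm//.
move: tr; rewrite ltr_pdivlMr// => /(le_lt_trans _); apply.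
by rewrite ler_wpM2l// lerDl.
Qed.

Section ddir.
Variables (B : set Y) (C K : R) (f : Y -> R).
Hypotheses (oB : open B) (C0 : 0 <= C).
Hypotheses (cf : semiconvex_on B C f) (lf : lipschitz_bound B K f).

(** Semiconvexity on the segment from [y] to [y + t *: v], at the point of
    parameter [s / t]. *)
Lemma dquot_mono y v s t : B y -> B (y + t *: v) -> 0 < s -> s <= t ->
  dquot f y v s + C * s * `|v| ^+ 2 <= dquot f y v t + C * t * `|v| ^+ 2.
Proof.
move=> By Bt s0 st; have t0 : 0 < t by exact: lt_le_trans st.
have u01 : 0 <= s / t <= 1.
  by rewrite ler_pdivrMr// mul1r st andbT divr_ge0// ltW.
have := cf By Bt u01.
rewrite scalerDr addrA -scalerDl subrK scale1r scalerA divfK ?gt_eqF//.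
have -> : y - (y + t *: v) = - (t *: v) by rewrite opprD addrA subrr sub0r.
rewrite normrN normrZ gtr0_norm// /dquot.
set fs := f (y + s *: v); set ft := f (y + t *: v); set n := `|v|; set fy := f y.
move=> H.
have e1 : (ft - fy) / t + C * t * n ^+ 2 - ((fs - fy) / s + C * s * n ^+ 2)
   = s^-1 * ((1 - s / t) * fy + s / t * ft +
     C * (s / t * (1 - s / t) * (t * n) ^+ 2) - fs).
  by field; rewrite !gt_eqF.
by rewrite -subr_ge0 e1 mulr_ge0 ?subr_ge0// invr_ge0 ltW.
Qed.

Lemma dquot_bound y v t : B y -> B (y + t *: v) -> 0 < t ->
  `|dquot f y v t| <= K * `|v|.
Proof.
move=> By Bt t0; rewrite /dquot normrM normfV (gtr0_norm t0) ler_pdivrMr//.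
apply: le_trans (lf Bt By) _.
by rewrite addrAC subrr add0r normrZ (gtr0_norm t0) mulrCA mulrC.
Qed.

Let ddset y v := [set dquot f y v t + C * t * `|v| ^+ 2 |
       t in [set t | 0 < t /\ B (y + t *: v)]].

Let ddset_has_inf y v : B y -> has_inf (ddset y v).
Proof.
move=> By; split.
  have [e e0 eB] := open_segment v oB By.
  exists (dquot f y v (e / 2) + C * (e / 2) * `|v| ^+ 2); exists (e / 2) => //.
  by split; [lra | apply: eB; lra].
exists (- (K * `|v|)) => _ [t [t0 Bt] <-].
have := dquot_bound By Bt t0; rewrite ler_norml => /andP[+ _].
have : 0 <= C * t * `|v| ^+ 2 by rewrite !mulr_ge0// ltW.
lra.
Qed.

Lemma ddir_le y v t : B y -> 0 < t -> B (y + t *: v) ->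
  ddir B C f y v <= dquot f y v t + C * t * `|v| ^+ 2.
Proof.
by move=> By t0 Bt; apply: ge_inf; [case: (ddset_has_inf v By)|exists t].
Qed.

Lemma ddir_approx y v (e : R) : B y -> 0 < e -> exists2 t0, 0 < t0 &
  forall t, 0 < t < t0 -> B (y + t *: v) /\ dquot f y v t <= ddir B C f y v + e.
Proof.
move=> By e0; have [_ [t1 [t10 Bt1] <-]] := inf_adherent e0 (ddset_has_inf v By).
move=> H; have [d d0 dB] := open_segment v oB By.
exists (Num.min t1 d); first by rewrite lt_min t10 d0.
move=> t; rewrite lt_min => /and3P[t0 tt1 td]; split; first by apply: dB; lra.
have := dquot_mono By Bt1 t0 (ltW tt1).
have : 0 <= C * t * `|v| ^+ 2 by rewrite !mulr_ge0// ltW.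
move: H; rewrite -/(ddir B C f y v); lra.
Qed.

Lemma ddir_ge y v : B y -> - (K * `|v|) <= ddir B C f y v.
Proof.
move=> By; apply: lb_le_inf; first by case: (ddset_has_inf v By).
move=> _ [t [t0 Bt] <-].
have := dquot_bound By Bt t0; rewrite ler_norml => /andP[+ _].
have : 0 <= C * t * `|v| ^+ 2 by rewrite !mulr_ge0// ltW.
lra.
Qed.

Lemma ddir_bound y v : B y -> ddir B C f y v <= K * `|v|.
Proof.
move=> By; apply: (@le_of_small_slack _ _ (C * `|v| ^+ 2)).
  by rewrite mulr_ge0.
move=> e e0; have [d d0 dB] := open_segment v oB By.
exists d => // t t0; have Bt : B (y + t *: v) by apply: dB; lra.
have := ddir_le By (proj1 (andP t0)) Bt.
have := dquot_bound By Bt (proj1 (andP t0)); rewrite ler_norml => /andP[_].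
by move: (dquot _ _ _ _) => q; nra.
Qed.

Lemma ddir0 y : B y -> ddir B C f y 0 = 0.
Proof.
move=> By; apply/eqP; rewrite eq_le.
by have := ddir_bound 0 By; have := ddir_ge 0 By; rewrite normr0 mulr0 oppr0 => -> ->.
Qed.

Lemma ddirZ_le y c v : B y -> 0 < c -> ddir B C f y (c *: v) <= c * ddir B C f y v.
Proof.
move=> By c0; apply: (@le_of_small_slack _ _ (C * `|c *: v| ^+ 2)).
  by rewrite mulr_ge0.
move=> e e0; have [d d0 dB] := @ddir_approx y v (e / c) By (divr_gt0 e0 c0).
exists (d / c); first by rewrite divr_gt0.
move=> t /andP[t0]; rewrite ltr_pdivlMr// => td.
have [Bt qt] := dB (t * c) ltac:(apply/andP; split => //; exact: mulr_gt0).
rewrite -scalerA in Bt; apply: (le_trans (ddir_le By t0 Bt)).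
have -> : dquot f y (c *: v) t = c * dquot f y v (t * c).
  by rewrite /dquot scalerA; field; rewrite !gt_eqF.
have : c * dquot f y v (t * c) <= c * (ddir B C f y v + e / c).
  by rewrite ler_pM2l.
rewrite mulrDr (mulrC c (e / c)) divfK ?gt_eqF//; lra.
Qed.

Lemma ddirZ y c v : B y -> 0 < c -> ddir B C f y (c *: v) = c * ddir B C f y v.
Proof.
move=> By c0; apply/eqP; rewrite eq_le ddirZ_le//=.
have := @ddirZ_le y c^-1 (c *: v) By; rewrite invr_gt0 => /(_ c0).
rewrite scalerA mulVf ?gt_eqF// scale1r => H.
by rewrite -ler_pdivlMl.
Qed.

(** The midpoint of [y + 2t *: v] and [y + 2t *: w] is [y + t *: (v + w)]. *)
Lemma ddirD y v w : B y ->
  ddir B C f y (v + w) <= ddir B C f y v + ddir B C f y w.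
Proof.
move=> By; apply: (@le_of_small_slack _ _ (C * (`|v - w| ^+ 2 + `|v + w| ^+ 2))).
  by rewrite mulr_ge0// addr_ge0.
move=> e e0.
have [d1 d10 dB1] := @ddir_approx y v (e / 2) By ltac:(lra).
have [d2 d20 dB2] := @ddir_approx y w (e / 2) By ltac:(lra).
have [d3 d30 dB3] := open_segment (v + w) oB By.
exists (Num.min d3 (Num.min (d1 / 2) (d2 / 2))).
  by rewrite !lt_min d30 !divr_gt0.
move=> t; rewrite !lt_min => /and4P[t0 t3 t1 t2].
have [B1 q1] := dB1 (2 * t) ltac:(lra).
have [B2 q2] := dB2 (2 * t) ltac:(lra).
have B3 := dB3 t ltac:(lra).
apply: (le_trans (ddir_le By t0 B3)).
have half01 : 0 <= (2^-1 : R) <= 1 by lra.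
have := cf B1 B2 half01.
have -> : (1 - 2^-1) *: (y + (2 * t) *: v) + 2^-1 *: (y + (2 * t) *: w) =
   y + t *: (v + w).
  rewrite !scalerDr !scalerA addrACA -scalerDl subrK scale1r.
  by congr (_ + (_ + _)); congr (_ *: _); field.
have -> : y + (2 * t) *: v - (y + (2 * t) *: w) = (2 * t) *: (v - w).
  by rewrite opprD addrACA subrr add0r scalerBr.
rewrite normrZ gtr0_norm ?mulr_gt0// => H.
set n1 := `|v - w| in H *; set n2 := `|v + w|.
have : dquot f y (v + w) t <= dquot f y v (2 * t) + dquot f y w (2 * t) + C * t * n1 ^+ 2.
  move: H; rewrite /dquot; set a := f (y + t *: (v + w)); set b := f (y + (2 * t) *: v).
  set c := f (y + (2 * t) *: w); set g := f y => H.
  have -> : (b - g) / (2 * t) + (c - g) / (2 * t) + C * t * n1 ^+ 2 =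
    ((1 - 2^-1) * b + 2^-1 * c + C * (2^-1 * (1 - 2^-1) * (2 * t * n1) ^+ 2) - g) / t.
    by field; rewrite gt_eqF.
  by rewrite ler_pM2r ?invr_gt0// lerB.
move: q1 q2; move: (dquot _ _ _ _) (dquot _ _ _ _) (dquot _ _ _ _) => x1 x2 x3.
nra.
Qed.

Lemma ddir_opp_ge y v : B y -> 0 <= ddir B C f y v + ddir B C f y (- v).
Proof. by move=> By; have := ddirD v (- v) By; rewrite subrr ddir0. Qed.

End ddir.
End semiconvex.

(** * Small oscillation of the derivative in an Asplund space *)

Section frechet.
Context {R : realType}.

Lemma differentiable_second_quotient (X : normedModType R) (p : X -> R^o) z :
  differentiable p z -> forall e : R, 0 < e ->
  exists2 d : R, 0 < d &
    forall h, `|h| <= d -> p (z + h) + p (z - h) - 2 * p z <= e * `|h|.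
Proof.
move=> dp e e0; have /eqaddoP/(_ (e / 2) ltac:(lra)) := diff_locally dp.
move=> /nbhs_ballP[d /= d0 dP]; exists (d / 2); first lra.
move=> h hd; have hh k : `|k| = `|h| ->
    `|p (k + z) - (p z + 'd p z k)| <= e / 2 * `|h|.
  move=> kh; rewrite -kh; apply: (dP k); rewrite -ball_normE /ball_ /= sub0r normrN kh.
  by apply: le_lt_trans hd _; lra.
have := hh h erefl; have := hh (- h) (normrN h).
rewrite linearN (addrC _ z) (addrC h) !ler_norml.
move: ('d p z h) => l; lra.
Qed.

Lemma differentiable_of_remainder (Y : normedModType R) (f : Y -> R) y
    (df : Y -> R) K :
  (forall c v w, df (c *: v + w) = c * df v + df w) ->
  (forall v, `|df v| <= K * `|v|) ->
  (forall e, 0 < e -> exists2 d, 0 < d & forall h, `|h| < d ->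
    `|f (y + h) - f y - df h| <= e * `|h|) ->
  differentiable (f : Y -> R^o) y.
Proof.
move=> dflin dfK H.
pose L : {linear Y -> R^o} :=
  HB.pack (df : Y -> R^o) (GRing.isLinear.Build R Y R^o *:%R df dflin).
have Lc : continuous L.
  apply/linear_bounded_continuous/linear_boundedP; near=> M => v.
  by apply: le_trans (dfK v) _; rewrite ler_wpM2r.
suff fL : (f : Y -> R^o) \o shift y = cst (f y : R^o) + L +o_ 0 id.
  by apply/diff_locallyP; rewrite (diff_unique Lc fL).
apply/eqaddoP => e e0; have [d d0 dP] := H _ e0.
apply/nbhs_ballP; exists d => //= h; rewrite -ball_normE /ball_ /= sub0r normrN.
by move=> /dP; rewrite -[X in _ -> `|X| <= _]/(f (h + y) - (f y + df h)) (addrC h) opprD addrA.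
Unshelve. all: by end_near. Qed.

Section oscillation.
Variables (X Y : normedModType R) (T : {linear X -> Y}).
Hypothesis T1 : forall x, `|T x| <= `|x|.
Variables (B : set Y) (C K : R) (f : Y -> R).
Hypotheses (oB : open B) (C0 : 0 <= C) (K0 : 0 <= K).
Hypotheses (cf : semiconvex_on B C f) (lf : lipschitz_bound B K f).
Variable U : set Y.
Hypotheses (oU : open U) (UB : U `<=` B) (U0 : U !=set0).

(** The support function of the set of all derivatives at the points of [U],
    pulled back along [T].  It is convex and continuous on [X], and it carries
    what is needed of the subdifferential of [f]. *)
Definition ddir_support x := sup [set ddir B C f y (T x) | y in U].

Let le_K (y : Y) x : U y -> ddir B C f y (T x) <= K * `|x|.
Proof.
move=> Uy; apply: (le_trans (ddir_bound oB C0 lf _ (UB Uy))).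
by rewrite ler_wpM2l.
Qed.

Let sup_support x : has_sup [set ddir B C f y (T x) | y in U].
Proof.
split; first by have [y Uy] := U0; exists (ddir B C f y (T x)); exists y.
by exists (K * `|x|) => _ [y Uy <-]; exact: le_K.
Qed.

Lemma ddir_le_support y x : U y -> ddir B C f y (T x) <= ddir_support x.
Proof. by move=> Uy; apply: ub_le_sup; [case: (sup_support x) | exists y]. Qed.

Lemma ddir_support_le x (M : R) :
  (forall y, U y -> ddir B C f y (T x) <= M) -> ddir_support x <= M.
Proof.
by move=> H; apply: ge_sup; [case: (sup_support x) | move=> _ [y /H Hy <-]].
Qed.

Lemma ddir_supportD x x' :
  ddir_support (x + x') <= ddir_support x + ddir_support x'.
Proof.
apply: ddir_support_le => y Uy; rewrite linearD.
apply: (le_trans (ddirD oB C0 cf lf _ _ (UB Uy))).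
by rewrite lerD// ddir_le_support.
Qed.

Lemma ddir_supportZ c x : 0 <= c -> ddir_support (c *: x) <= c * ddir_support x.
Proof.
move=> c0; apply: ddir_support_le => y Uy; move: c0; rewrite [0 <= c]le_eqVlt => /orP[/eqP <-|c0].
  by rewrite scale0r linear0 (ddir0 oB C0 lf) ?mul0r//; exact: UB.
rewrite linearZ (ddirZ oB C0 cf lf)//; last exact: UB.
by rewrite ler_pM2l// ddir_le_support.
Qed.

Lemma ddir_support_lip x x' :
  `|ddir_support x - ddir_support x'| <= K * `|x - x'|.
Proof.
have H a b : ddir_support a - ddir_support b <= K * `|a - b|.
  rewrite lerBlDl; have := ddir_supportD b (a - b); rewrite addrC subrK => /le_trans; apply.
  by rewrite lerD2l; apply: ddir_support_le => y /le_K.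
by rewrite ler_norml H andbT lerNl opprB distrC H.
Qed.

Lemma ddir_support_continuous : continuous (ddir_support : X -> R^o).
Proof.
move=> x; apply/cvgrPdist_le => e e0; have K1 : 0 < K + 1 by rewrite ltr_wpDl.
near=> x'; apply: (le_trans (ddir_support_lip x x')).
have : `|x - x'| <= e / (K + 1).
  by near: x'; apply: cvgr_dist_le; [exact: cvg_id | rewrite divr_gt0].
rewrite ler_pdivlMr// => H.
by apply: le_trans H; rewrite mulrC ler_wpM2l// lerDl.
Unshelve. all: by end_near. Qed.

Lemma ddir_support_convex : convex_function setT ddir_support.
Proof.
move=> t x x' _ _; rewrite convRE.
apply: (le_trans (ddir_supportD _ _)).
apply: lerD; apply: ddir_supportZ; first by [].
by rewrite subr_ge0.
Qed.

(** Differentiability of the support function at [z] says that its slopes in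
    the directions [h] and [- h] nearly cancel.  Pick [y] whose derivative along
    [T z] nearly attains the supremum and move to [y' = y + t *: T z]: by
    monotonicity the derivative at [y'] along [- T z] is nearly as small as it
    can be, and by upper semicontinuity this persists on a ball [V] around [y'].
    On [V] subadditivity bounds the derivative along [T h] by the increment of
    the support function from [z] to [z + h]. *)
Lemma small_oscillation z e : differentiable (ddir_support : X -> R^o) z ->
  0 < e ->
  exists V : set Y, [/\ open V, V !=set0, V `<=` U &
    forall v v' h, V v -> V v' ->
      ddir B C f v (T h) + ddir B C f v' (- T h) <= e * `|h|].
Proof.
move=> dz e0.
have [d d0 dP] := differentiable_second_quotient dz (divr_gt0 e0 (ltr0n _ 3)).
pose eta := e / 3 * d; have eta0 : 0 < eta by rewrite !mulr_gt0// invr_gt0.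
have [_ [y Uy <-] yz] := sup_adherent eta0 (sup_support z).
rewrite -/(ddir_support z) in yz; have By := UB Uy.
pose n := `|T z|; have n0 : 0 <= n by exact: normr_ge0.
have [t1 t10 Ut1] := open_segment (T z) oU Uy.
pose t := Num.min (t1 / 2) ((ddir B C f y (T z) - (ddir_support z - eta)) / 2 / (2 * C * n ^+ 2 + 1)).
have Cn : 0 <= C * n ^+ 2 by rewrite mulr_ge0// exprn_ge0.
have gap : 0 < ddir B C f y (T z) - (ddir_support z - eta) by rewrite subr_gt0.
have t0 : 0 < t by rewrite lt_min !divr_gt0//; lra.
have tt1 : 0 <= t < t1.
  by rewrite ltW//= (@le_lt_trans _ _ (t1 / 2))// ?ge_min ?lexx//; lra.
have tC : t * (2 * C * n ^+ 2 + 1) <= (ddir B C f y (T z) - (ddir_support z - eta)) / 2.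
  by rewrite -ler_pdivlMr ?ge_min ?lexx ?orbT//; lra.
pose y' := y + t *: T z; have Uy' : U y' := Ut1 _ tt1; have By' := UB Uy'.
have y'E : y' + t *: - T z = y by rewrite /y' scalerN addrK.
have qy' : dquot f y' (- T z) t = - dquot f y (T z) t.
  by rewrite /dquot y'E -mulNr opprB.
have key : dquot f y' (- T z) t + C * t * `|- T z| ^+ 2 < - (ddir_support z - eta).
  rewrite qy' normrN -/n.
  have := ddir_le oB C0 lf By t0 By'; rewrite -/n; nra.

(* The quotient of step [t] at [y'] is minus the one at [y]; its strict
   inequality survives a small change of the base point. *)
pose gap' := - (ddir_support z - eta) - (dquot f y' (- T z) t + C * t * `|- T z| ^+ 2).
have gap'0 : 0 < gap' by rewrite subr_gt0.
have /nbhs_ballP[r1 /= r10 Ur1] : nbhs y' U by exact: open_nbhs_nbhs.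
have /nbhs_ballP[r2 /= r20 Br2] : nbhs y B by exact: open_nbhs_nbhs.
pose r := Num.min (Num.min r1 r2) (gap' * t / (2 * K + 1)).
have K1 : 0 < 2 * K + 1 by have := K0; lra.
have r0 : 0 < r by rewrite !lt_min r10 r20 divr_gt0// mulr_gt0.
have VU : ball y' r `<=` U.
  by move=> v yv; apply: Ur1; apply: le_ball yv; rewrite !ge_min lexx.
have Vz v : ball y' r v -> ddir B C f v (- T z) <= - (ddir_support z - eta).
  move=> yv; have Bv := UB (VU _ yv).
  have yvE : v + t *: - T z - y = v - y'.
    by rewrite /y' scalerN opprD addrA addrAC.
  have Bw : B (v + t *: - T z).
    apply: Br2; rewrite -ball_normE /ball_ /= -normrN opprB yvE -normrN opprB.
    move: yv; rewrite -ball_normE /ball_ /= => /lt_le_trans; apply.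
    by rewrite !ge_min lexx orbT.
  apply: (le_trans (ddir_le oB C0 lf Bv t0 Bw)).
  have l1 := lf Bv By'; have l2 := lf Bw By.
  rewrite yvE in l2.
  have : `|v - y'| * (2 * K + 1) < gap' * t.
    rewrite -ltr_pdivlMr// distrC; move: yv; rewrite -ball_normE /ball_ /=.
    by move=> /lt_le_trans; apply; rewrite ge_min lexx orbT.
  move=> l3; rewrite -lerBrDr.
  have -> : - (ddir_support z - eta) - C * t * `|- T z| ^+ 2 =
    gap' + dquot f y' (- T z) t by rewrite /gap'; ring.
  rewrite /dquot y'E -lerBlDr -mulrBl ler_pdivrMr//.
  move: l1 l2 l3; rewrite !ler_norml => /andP[a1 a2] /andP[b1 b2].
  have := normr_ge0 (v - y'); move: (`|_|) a1 a2 b1 b2 => m; nra.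
have osc_d v v' h : ball y' r v -> ball y' r v' -> `|h| = d ->
    ddir B C f v (T h) + ddir B C f v' (- T h) <= e * `|h|.
  move=> yv yv' hd.
  have h1 : ddir B C f v (T h) <= ddir_support (z + h) - (ddir_support z - eta).
    have -> : T h = T (z + h) + - T z by rewrite linearD addrC addKr.
    apply: (le_trans (ddirD oB C0 cf lf _ _ (UB (VU _ yv)))).
    by rewrite lerD// ?Vz// ddir_le_support//; exact: VU.
  have h2 : ddir B C f v' (- T h) <= ddir_support (z - h) - (ddir_support z - eta).
    have -> : - T h = T (z - h) + - T z by rewrite linearB addrC addKr.
    apply: (le_trans (ddirD oB C0 cf lf _ _ (UB (VU _ yv')))).
    by rewrite lerD// ?Vz// ddir_le_support//; exact: VU.
  have := dP h ltac:(by rewrite hd); rewrite hd.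
  by move: h1 h2; rewrite /eta; lra.
exists (ball y' r); split => //.
- exact: ball_open.
- by exists y'; exact: ballxx.
move=> v v' h yv yv'; have [->|hn0] := eqVneq h 0.
  by rewrite linear0 oppr0 normr0 mulr0 !(ddir0 oB C0 lf) ?addr0//; exact/UB/VU.
have h0 : 0 < `|h| by rewrite normr_gt0.
have dh : 0 < d / `|h| by rewrite divr_gt0.
have := osc_d v v' ((d / `|h|) *: h) yv yv'.
rewrite normrZ gtr0_norm// divfK ?gt_eqF// => /(_ erefl).
rewrite linearZ -scalerN !(ddirZ oB C0 cf lf)//; [|exact/UB/VU|exact/UB/VU].
rewrite -mulrDr mulrAC ler_pdivrMr// (mulrC e) -mulrA ler_pM2l//.
Qed.

End oscillation.
End frechet.

(** * Generic Frechet differentiability of semiconvex functions *)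

Section generic.
Context {R : realType}.

Definition locally_semiconvex (Y : normedModType R) (W : set Y) (f : Y -> R) :=
  forall p, W p -> exists B C K, [/\ open B, B p, 0 <= C /\ 0 <= K,
    semiconvex_on B C f & lipschitz_bound B K f].

(** Oscillation is measured with difference quotients of small step: unlike
    [ddir], they do not depend on a choice of semiconvexity data around each
    point, so that the sets below are globally defined. *)
Definition small_osc (X Y : normedModType R) (T : X -> Y) (f : Y -> R) (e : R)
    (V : set Y) :=
  forall v v' h, V v -> V v' -> forall eta : R, 0 < eta ->
  exists2 d : R, 0 < d & forall t, 0 < t < d ->
    dquot f v (T h) t + dquot f v' (- T h) t <= e * `|h| + eta.

Definition osc_set (X Y : normedModType R) (T : X -> Y) (f : Y -> R) (e : R) :=
  \bigcup_(V in [set V | open V /\ small_osc T f e V]) V.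

Lemma osc_set_open (X Y : normedModType R) (T : X -> Y) (f : Y -> R) (e : R) :
  open (osc_set T f e).
Proof. by apply: bigcup_open => V []. Qed.

Lemma osc_set_meets (X : completeNormedModType R) (Y : normedModType R)
    (T : {linear X -> Y}) (f : Y -> R) (e : R) (W U : set Y) :
  asplund X -> (forall x, `|T x| <= `|x|) -> locally_semiconvex W f ->
  0 < e -> open U -> U `&` W !=set0 -> U `&` osc_set T f e !=set0.
Proof.
move=> HA T1 lsc e0 oU [p [Up Wp]].
have [B [C [K [oB Bp [C0 K0] cf lf]]]] := lsc p Wp.
have oUB : open (U `&` B) by exact: openI.
have UB : U `&` B `<=` B by exact: subIsetr.
have UB0 : U `&` B !=set0 by exists p.
have [D [_ dD] diffD] := HA _ (ddir_support_continuous T1 oB C0 K0 cf lf UB UB0)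
  (ddir_support_convex T1 oB C0 K0 cf lf UB UB0).
have [z [_ Dz]] := dD setT (ex_intro _ 0 I) openT.
have [V [oV [v Vv] VU VP]] :=
  small_oscillation T1 oB C0 K0 cf lf oUB UB UB0 (diffD z Dz) e0.
exists v; split; first by case: (VU _ Vv).
exists V => //; split=> // w w' h Vw Vw' eta eta0.
have Bw := UB _ (VU _ Vw); have Bw' := UB _ (VU _ Vw').
have [d1 d10 P1] := ddir_approx oB C0 cf lf (T h) Bw (divr_gt0 eta0 (ltr0n _ 2)).
have [d2 d20 P2] := ddir_approx oB C0 cf lf (- T h) Bw' (divr_gt0 eta0 (ltr0n _ 2)).
exists (Num.min d1 d2); first by rewrite lt_min d10.
move=> t; rewrite lt_min => /and3P[t0 t1 t2].
have [_ a1] := P1 t ltac:(lra); have [_ a2] := P2 t ltac:(lra).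
have := VP _ _ h Vw Vw'; lra.
Qed.

(** Letting [e] go to [0], the derivative at [y] becomes odd, hence linear.
    The increment of [f] from [y] to [y + h] lies, up to [C * `|h| ^+ 2],
    between the derivative at [y] along [h] and minus the derivative at [y + h]
    along [- h], and these differ by at most [e * `|h|]. *)
Lemma frechet_of_osc (Y X1 X2 : normedModType R)
    (T1 : X1 -> Y) (T2 : X2 -> Y) (f : Y -> R) (W : set Y) y :
  (forall h, exists h1 h2,
     [/\ h = T1 h1 + T2 h2, `|h1| <= `|h| & `|h2| <= `|h|]) ->
  locally_semiconvex W f -> W y ->
  (forall e, 0 < e -> osc_set T1 f e y /\ osc_set T2 f e y) ->
  differentiable (f : Y -> R^o) y.
Proof.
move=> dec lsc Wy osc; have [B [C [K [oB By [C0 K0] cf lf]]]] := lsc y Wy.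
pose D := ddir B C f.
have oscD (X : normedModType R) (T : X -> Y) e V v v' h : small_osc T f e V ->
    V v -> V v' -> B v -> B v' -> D v (T h) + D v' (- T h) <= e * `|h|.
  move=> oV Vv Vv' Bv Bv'.
  apply: (@le_of_small_slack _ _ _ (2 * (C * `|T h| ^+ 2))).
    by rewrite !mulr_ge0// exprn_ge0.
  move=> eta eta0; have [d d0 dP] := oV v v' h Vv Vv' eta eta0.
  have [d1 d10 P1] := open_segment (T h) oB Bv.
  have [d2 d20 P2] := open_segment (- T h) oB Bv'.
  exists (Num.min d (Num.min d1 d2)); first by rewrite !lt_min d0 d10.
  move=> t; rewrite !lt_min => /and4P[t0 td t1 t2].
  have := ddir_le oB C0 lf Bv t0 (P1 t ltac:(lra)).
  have := ddir_le oB C0 lf Bv' t0 (P2 t ltac:(lra)).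
  have := dP t ltac:(lra).
  by rewrite normrN /D; lra.
have osc_all e : 0 < e -> exists V, [/\ open V, V y, V `<=` B &
    forall v v' h, V v -> V v' -> D v h + D v' (- h) <= e * `|h|].
  move=> e0; have [[V1 [oV1 sV1] V1y] [V2 [oV2 sV2] V2y]] := osc _ (divr_gt0 e0 (ltr0n _ 2)).
  exists (V1 `&` V2 `&` B); split => //; first by do 2 apply: openI => //.
  move=> v v' h [[v1 v2] Bv] [[v1' v2'] Bv']; have [h1 [h2 [-> h1h h2h]]] := dec h.
  have a1 := oscD _ _ _ _ _ _ h1 sV1 v1 v1' Bv Bv'.
  have a2 := oscD _ _ _ _ _ _ h2 sV2 v2 v2' Bv Bv'.
  have := ddirD oB C0 cf lf (T1 h1) (T2 h2) Bv.
  have := ddirD oB C0 cf lf (- T1 h1) (- T2 h2) Bv'.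
  rewrite -opprD -/D; move: a1 a2; nra.
have Dopp v : D y (- v) = - D y v.
  apply/eqP; rewrite -addr_eq0 addrC eq_le (ddir_opp_ge oB C0 cf lf)// andbT.
  apply: (@le_of_small_slack _ _ _ 0) => // e e0; exists 1 => // t _; rewrite mul0r addr0 add0r.
  have v1 : 0 < `|v| + 1 by rewrite ltr_wpDl.
  have [V [oV Vy _ VP]] := osc_all (e / (`|v| + 1)) (divr_gt0 e0 v1).
  apply: (le_trans (VP y y v Vy Vy)); rewrite mulrAC ler_pdivrMr// ler_wpM2l ?ltW//.
  by rewrite ltrDl.
have DD v w : D y (v + w) = D y v + D y w.
  apply/eqP; rewrite eq_le (ddirD oB C0 cf lf)//=.
  have := ddirD oB C0 cf lf (- v) (- w) By.
  by rewrite -/D -opprD !Dopp -opprD lerN2.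
apply: (@differentiable_of_remainder _ _ _ _ (D y) K).
- move=> c v w; rewrite DD; congr (_ + _).
  have [c0|c0|->] := ltgtP c 0; first last.
  + by rewrite scale0r mul0r /D (ddir0 oB C0 lf).
  + by rewrite /D (ddirZ oB C0 cf lf).
  rewrite -[c]opprK scaleNr Dopp mulNr; congr (- _).
  by rewrite /D (ddirZ oB C0 cf lf) ?oppr_gt0.
- move=> v; rewrite ler_norml /D.
  by rewrite (ddir_ge oB C0 lf)// (ddir_bound oB C0 lf).
move=> e e0; have [V [oV Vy VB VP]] := osc_all (e / 2) ltac:(lra).
have /nbhs_ballP[r /= r0 rV] : nbhs y V by exact: open_nbhs_nbhs.
have C1 : 0 < 2 * C + 1 by lra.
exists (Num.min r (e / (2 * C + 1))); first by rewrite lt_min r0 divr_gt0.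
move=> h; rewrite lt_min ltr_pdivlMr// => /andP[hr hC].
have Vh : V (y + h).
  by apply: rV; rewrite -ball_normE /ball_ /= opprD addrA subrr sub0r normrN.
have Bh := VB _ Vh.
have := ddir_le oB C0 lf (v := h) By ltr01; rewrite scale1r => /(_ Bh).
have := ddir_le oB C0 lf (v := - h) Bh ltr01; rewrite scale1r addrK => /(_ By).
rewrite /dquot !scale1r addrK !divr1 !mulr1 normrN -/D.
have := VP _ _ h Vh Vy; rewrite Dopp.
have := ddir_opp_ge oB C0 cf lf h Bh; rewrite -/D => a1 a2 a3 a4.
have h0 := normr_ge0 h.
rewrite ler_norml; move: a1 a2 a3 a4 hC; move: (D _ _) (D _ _) (D _ _) (f _) (f _) (`|h|) h0.
move=> x1 x2 x3 x4 x5 n n0 *; nra.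
Qed.

(** With the two embeddings of [X] into [X * X], the result applies to functions
    on [X * X] under a hypothesis on [X] alone: the oscillation is made small
    first along one factor and then along the other. *)
Lemma generic_frechet (Y : completeNormedModType R) (X1 X2 : completeNormedModType R)
    (T1 : {linear X1 -> Y}) (T2 : {linear X2 -> Y}) (f : Y -> R) (W : set Y) :
  asplund X1 -> asplund X2 ->
  (forall x, `|T1 x| <= `|x|) -> (forall x, `|T2 x| <= `|x|) ->
  (forall h, exists h1 h2,
     [/\ h = T1 h1 + T2 h2, `|h1| <= `|h| & `|h2| <= `|h|]) ->
  open W -> locally_semiconvex W f ->
  exists2 D, dense_Gdelta_in W D & forall y, D y -> differentiable (f : Y -> R^o) y.
Proof.
move=> A1 A2 n1 n2 dec oW lsc.
pose E n : R := n.+1%:R^-1; have E0 n : 0 < E n by rewrite invr_gt0.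
(* Outside the closure of [W] density is for free, so adding its complement
   makes the sets dense in the whole space, as Baire requires. *)
pose G n := (osc_set T1 f (E n) `&` osc_set T2 f (E n)) `|` ~` closure W.
have oG n : open (G n).
  apply: openU; last by rewrite openC; exact: closed_closure.
  by apply: openI; exact: osc_set_open.
have meet U n : open U -> U `&` W !=set0 ->
    U `&` (osc_set T1 f (E n) `&` osc_set T2 f (E n)) !=set0.
  move=> oU UW; have oUW : open (U `&` W) by exact: openI.
  have [] := @osc_set_meets _ _ T1 f (E n) W (U `&` W) A1 n1 lsc (E0 n) oUW.
    by move: UW => [x [? ?]]; exists x.
  move=> x [[Ux Wx] Ox].
  have [] := @osc_set_meets _ _ T2 f (E n) W (U `&` W `&` osc_set T1 f (E n)) A2 n2 lsc (E0 n).
  - by apply: openI => //; exact: osc_set_open.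
  - by exists x.
  by move=> z [[[Uz _] Oz] Oz2]; exists z.
have dG n : dense (G n).
  move=> U [x Ux] oU; have [UW|UW] := pselect (U `&` W !=set0).
    by have [z [Uz Oz]] := meet U n oU UW; exists z; split => //; left.
  exists x; split => //; right => /(_ U); apply: contrapT => -[].
  by rewrite setIC => H; apply: UW; apply: H; exact: open_nbhs_nbhs.
have dI : dense (\bigcap_n G n) by exact: Baire.
exists (W `&` \bigcap_n G n); first split.
- by exists (\bigcap_n G n) => //; exists G.
- move=> x Wx U /= ; rewrite nbhsE => -[V [oV Vx] VU].
  have [] := dI (V `&` W); [by exists x | exact: openI |].
  by move=> z [[Vz Wz] Gz]; exists z; split => //; exact: VU.
move=> y [Wy Gy]; apply: (frechet_of_osc dec lsc Wy) => e e0.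
have [n _ ne] : \forall n \near \oo, E n < e.
  exact: near_infty_natSinv_lt (PosNum e0).
have {ne} ne := ne n (leqnn n).
have [[[V1 [? s1] ?] [V2 [? s2] ?]]|[]] := Gy n I; last exact: subset_closure.
have mono (X : normedModType R) (T : X -> Y) V : small_osc T f (E n) V -> small_osc T f e V.
  move=> s v v' h Vv Vv' eta eta0; have [d d0 dP] := s v v' h Vv Vv' eta eta0.
  exists d => // t /dP /le_trans; apply; rewrite lerD2r ler_wpM2r// ltW//.
by split; [exists V1 => //; split => //; exact: mono
          |exists V2 => //; split => //; exact: mono].
Qed.

End generic.

(** * Completeness of products *)

Section product.
Context {R : realType} (X Y : completeNormedModType R).

(** A base point together with completeness makes the product of two Banach
    spaces a [completeNormedModType], to which Baire's theorem applies. *)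
HB.instance Definition _ := isPointed.Build (X * Y)%type 0.

Lemma prod_cauchy_cvg (F : set_system (X * Y)) :
  ProperFilter F -> cauchy F -> cvg F.
Proof.
move=> FF /cauchy_ballP Fc.
have c1 : cvg (fst @ F).
  apply: cauchy_cvg; apply/cauchy_ballP => e e0; have [[A B] [/= FA FB] AB] := Fc e e0.
  exists (fst @` A, fst @` B) => /=.
    by split; [apply: filterS FA|apply: filterS FB] => x Ax; exists x.
  by move=> [_ _] /= [[x Ax <-] [y By <-]]; have [] := AB (x, y) (conj Ax By).
have c2 : cvg (snd @ F).
  apply: cauchy_cvg; apply/cauchy_ballP => e e0; have [[A B] [/= FA FB] AB] := Fc e e0.
  exists (snd @` A, snd @` B) => /=.
    by split; [apply: filterS FA|apply: filterS FB] => x Ax; exists x.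
  by move=> [_ _] /= [[x Ax <-] [y By <-]]; have [] := AB (x, y) (conj Ax By).
have := cvg_pair c1 c2.
rewrite (_ : (fun x => (x.1, x.2)) = id); last by apply/funext => -[].
by move=> H; apply/cvg_ex; exists (lim (fst @ F), lim (snd @ F)); exact: H.
Qed.

HB.instance Definition _ := Uniform_isComplete.Build (X * Y)%type prod_cauchy_cvg.

End product.

(** * The distance to the boundary *)

Section boundary_distance.
Context {R : realType} {X : completeNormedModType R} (Omega : set X).
Hypothesis Hdom : domain Omega.
Local Notation d := (boundary_dist Omega).

Let oOmega : open Omega. Proof. by case: Hdom. Qed.

Lemma boundary_disjoint a : boundary Omega a -> ~ Omega a.
Proof. by move=> [_ ni] Oa; apply: ni; exact: open_nbhs_nbhs. Qed.

Let dist_has_inf z : has_inf [set `|z - a| | a in boundary Omega].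
Proof.
split; first by have [_ _ [a ba]] := Hdom; exists `|z - a|; exists a.
by exists 0 => _ [a _ <-].
Qed.

Lemma boundary_dist_le z a : boundary Omega a -> d z <= `|z - a|.
Proof. by move=> ba; apply: ge_inf; [case: (dist_has_inf z) | exists a]. Qed.

Lemma boundary_dist_ge z (D : R) :
  (forall a, boundary Omega a -> D <= `|z - a|) -> D <= d z.
Proof.
by move=> H; apply: lb_le_inf; [case: (dist_has_inf z) | move=> _ [a /H Ha <-]].
Qed.

Lemma boundary_dist_lip z w : d z <= d w + `|z - w|.
Proof.
rewrite -lerBlDr; apply: boundary_dist_ge => a ba.
rewrite lerBlDr; apply: (le_trans (boundary_dist_le z ba)).
by rewrite [leRHS]addrC ler_distD.
Qed.

Lemma boundary_dist_gt0 z : Omega z -> 0 < d z.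
Proof.
move=> Oz; have /nbhs_ballP[r /= r0 rO] : nbhs z Omega by exact: open_nbhs_nbhs.
apply: (lt_le_trans r0); apply: boundary_dist_ge => a ba.
rewrite leNgt; apply/negP => az; apply: (boundary_disjoint ba); apply: rO.
by rewrite -ball_normE.
Qed.

(** Otherwise the last point of the segment from [z] to [w] before leaving
    [Omega] would be a boundary point that is too close to [z]. *)
Lemma boundary_dist_ball z w : Omega z -> `|w - z| < d z -> Omega w.
Proof.
move=> Oz wz; apply: contrapT => nOw.
pose g (t : R) := z + t *: (w - z).
pose S : set R := [set t | 0 <= t <= 1 /\ Omega (g t)].
have g0 : g 0 = z by rewrite /g scale0r addr0.
have g1 : g 1 = w by rewrite /g scale1r addrC subrK.
have S0 : S 0 by split; rewrite ?g0// lexx ler01.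
have hS : has_sup S by split; [exists 0 | exists 1 => t [/andP[]]].
pose t := sup S.
have t0 : 0 <= t by apply: ub_le_sup S0; case: hS.
have t1 : t <= 1 by apply: ge_sup => [|u [/andP[]]//]; exists 0.
have w0 : 0 < `|w - z| + 1 by rewrite ltr_wpDl.
have gdist u : `|g t - g u| = `|t - u| * `|w - z|.
  by rewrite /g opprD addrACA subrr add0r -scalerBl normrZ.
have bt : boundary Omega (g t).
  split.
    move=> U /nbhs_ballP[r /= r0 rU].
    have [u Su tu] := sup_adherent (divr_gt0 r0 w0) hS; rewrite -/t in tu.
    have ut : u <= t by apply: ub_le_sup Su; case: hS.
    exists (g u); split; first by case: Su.
    apply: rU; rewrite -ball_normE /ball_ /= gdist ger0_norm ?subr_ge0//.
    have : (t - u) * (`|w - z| + 1) < r by rewrite -ltr_pdivlMr//; lra.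
    by apply: le_lt_trans; rewrite ler_wpM2l ?subr_ge0// lerDl.
  rewrite /= => /interior_subset Ogt.
  have t1' : t < 1.
    by rewrite lt_neqAle t1 andbT; apply/eqP => tE; apply: nOw; rewrite -g1 -tE.
  have /nbhs_ballP[r /= r0 rO] : nbhs (g t) Omega by exact: open_nbhs_nbhs.
  pose e := Num.min (1 - t) (r / 2 / (`|w - z| + 1)).
  have e0 : 0 < e by rewrite lt_min subr_gt0 t1' !divr_gt0.
  have e1 : e <= 1 - t by rewrite ge_min lexx.
  have e2 : e * (`|w - z| + 1) <= r / 2 by rewrite -ler_pdivlMr// ge_min lexx orbT.
  suff : t + e <= t by rewrite gerDl leNgt e0.
  apply: ub_le_sup; first by case: hS.
  split; first lra.
  apply: rO; rewrite -ball_normE /ball_ /= gdist opprD addrA subrr sub0r normrN.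
  rewrite gtr0_norm//; have : e * `|w - z| <= e * (`|w - z| + 1).
    by rewrite ler_wpM2l ?lerDl// ltW.
  lra.
have := boundary_dist_le z bt; have := gdist 0.
rewrite g0 subr0 (ger0_norm t0) distrC => -> dle.
have : t * `|w - z| <= `|w - z| by rewrite ler_piMl.
lra.
Qed.

Lemma boundary_dist_ge_ball z (D : R) :
  (forall w, `|w - z| < D -> Omega w) -> D <= d z.
Proof.
move=> H; apply: boundary_dist_ge => a ba; rewrite leNgt; apply/negP => az.
by apply: (boundary_disjoint ba); apply: H; rewrite distrC.
Qed.

Hypothesis Hconv : convex_set Omega.

Lemma convex_set_comb a b (s : R) : Omega a -> Omega b -> 0 <= s <= 1 ->
  Omega ((1 - s) *: a + s *: b).
Proof.
move=> Oa Ob /andP[s0 s1].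
have := @Hconv b a (Itv01 s0 s1); rewrite !inE addrC; exact.
Qed.

(** The ball of radius [D] around the convex combination is the convex
    combination of the balls of radii [d a] and [d b] around [a] and [b]. *)
Lemma boundary_dist_concave a b (s : R) : Omega a -> Omega b -> 0 <= s <= 1 ->
  (1 - s) * d a + s * d b <= d ((1 - s) *: a + s *: b).
Proof.
move=> Oa Ob s01; have da := boundary_dist_gt0 Oa; have db := boundary_dist_gt0 Ob.
pose D := (1 - s) * d a + s * d b.
have D0 : 0 < D by rewrite /D; move: s01 => /andP[]; nra.
apply: boundary_dist_ge_ball => w; rewrite -/D => wD.
pose u := D^-1 *: (w - ((1 - s) *: a + s *: b)).
have u1 : `|u| < 1.
  by rewrite normrZ gtr0_norm ?invr_gt0// mulrC ltr_pdivrMr// mul1r.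
have Oau c : Omega c -> Omega (c + d c *: u).
  move=> Oc; have dc := boundary_dist_gt0 Oc; apply: (boundary_dist_ball Oc).
  by rewrite addrAC subrr add0r normrZ gtr0_norm// gtr_pMr.
have uE : D *: u = w - ((1 - s) *: a + s *: b).
  by rewrite scalerA divff ?gt_eqF// scale1r.
have -> : w = (1 - s) *: (a + d a *: u) + s *: (b + d b *: u).
  move: (u) uE => u' uE.
  by rewrite !scalerDr !scalerA addrACA -scalerDl -/D uE addrC subrK.
exact: convex_set_comb (Oau _ Oa) (Oau _ Ob) s01.
Qed.

End boundary_distance.

(** * Chains *)

Section chains.
Context {R : realType} {X : completeNormedModType R} (Omega : set X).
Local Notation d := (boundary_dist Omega).

(** A discrete substitute for curves: each step has quasihyperbolic length
    about [r], so that [N%:R * r] plays the role of the length. *)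
Definition qh_chain (r : R) (N : nat) (x y : X) (z : nat -> X) :=
  [/\ z 0%N = x, z N = y, forall i, (i <= N)%N -> Omega (z i) &
      forall i, (i < N)%N -> `|z i.+1 - z i| <= r * d (z i)].

Hypothesis Hdom : domain Omega.

Lemma qh_chain_stay r N M x y z : 0 <= r -> (N <= M)%N ->
  qh_chain r N x y z -> qh_chain r M x y (fun i => z (minn i N)).
Proof.
move=> r0 NM [z0 zN Oz sz]; split => [||i iM|i iM].
- by rewrite min0n.
- by rewrite (minn_idPr NM).
- by apply: Oz; exact: geq_minr.
- case: (ltnP i N) => iN.
    have -> : minn i.+1 N = i.+1 by apply/minn_idPl.
    exact: sz.
  have -> : minn i.+1 N = N by apply/minn_idPr/leqW.
  rewrite subrr normr0 mulr_ge0//.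
  by apply/ltW/(boundary_dist_gt0 Hdom)/Oz.
Qed.

Lemma qh_chain_cat r N M x y w z z' : qh_chain r N x y z ->
  qh_chain r M y w z' ->
  qh_chain r (N + M) x w (fun i => if (i <= N)%N then z i else z' (i - N)%N).
Proof.
move=> [z0 zN Oz sz] [z0' zM Oz' sz']; split => [||i iM|i iM].
- by rewrite leq0n.
- case: leqP; last by rewrite addKn.
  rewrite -{2}[N]addn0 leq_add2l leqn0 => /eqP M0.
  by rewrite M0 addn0 zN -z0' -zM M0.
- case: leqP => iN; first exact: Oz.
  by apply: Oz'; rewrite leq_subLR.
- case: (ltngtP i N) => iN.
  + by apply: sz.
  + rewrite subSn ?(ltnW iN)//; apply: sz'.
    by rewrite ltn_subLR// ltnW.
  + rewrite iN zN subSn// subnn -z0'; apply: sz'.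
    by move: iM; rewrite iN -{1}[N]addn0 ltn_add2l.
Qed.

Lemma qh_chain_prefix r N M x y z : (M <= N)%N -> qh_chain r N x y z ->
  qh_chain r M x (z M) z.
Proof.
move=> MN [z0 zN Oz sz]; split => // i iM.
- by apply: Oz; exact: leq_trans MN.
- by apply: sz; exact: leq_trans MN.
Qed.

(** Going back along the chain, each step divides the distance to the boundary
    by at least [1 - r]; Bernoulli's inequality turns this into a linear
    bound. *)
Lemma qh_chain_dist r N x y z j : 0 <= r -> qh_chain r N x y z ->
  (j <= N)%N -> j%:R * r <= 1 -> d (z (N - j)%N) * (1 - j%:R * r) <= d y.
Proof.
move=> r0 [z0 zN Oz sz]; elim: j => [_ _|j IH jN jr].
  by rewrite subn0 zN mul0r subr0 mulr1.
have jr' : j%:R * r <= 1 by apply: le_trans jr; rewrite ler_wpM2r// ler_nat.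
apply: le_trans (IH (ltnW jN) jr'); set m := (N - j.+1)%N.
have mE : (N - j = m.+1)%N by rewrite /m subnS prednK// subn_gt0.
have mN : (m < N)%N by rewrite -mE leq_subr.
rewrite mE; have := boundary_dist_lip Hdom (z m) (z m.+1).
rewrite distrC => dm; have := sz m mN => sm.
have dp := boundary_dist_gt0 Hdom (Oz _ (ltnW mN)).
have : d (z m) * (1 - r) * (1 - j%:R * r) <= d (z m.+1) * (1 - j%:R * r).
  by rewrite ler_wpM2r ?subr_ge0//; lra.
apply: le_trans; rewrite -mulrA ler_wpM2l ?(ltW dp)//.
rewrite -natr1; have : 0 <= j%:R :> R by []; nra.
Qed.

Lemma qh_chain_segment x y r : Omega x -> Omega y ->
  `|y - x| <= r * d x -> qh_chain r 1 x y (fun i => if i is 0%N then x else y).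
Proof. by move=> Ox Oy xy; split => //; case. Qed.

Hypothesis Hconv : convex_set Omega.

(** Concavity of the distance to the boundary: averaging keeps the bound on
    the relative size of the steps. *)
Lemma qh_chain_average r N x0 y0 x1 y1 z0 z1 s : 0 <= s <= 1 -> 0 <= r ->
  qh_chain r N x0 y0 z0 -> qh_chain r N x1 y1 z1 ->
  qh_chain r N ((1 - s) *: x0 + s *: x1) ((1 - s) *: y0 + s *: y1)
    (fun i => (1 - s) *: z0 i + s *: z1 i).
Proof.
move=> s01 r0 [<- <- Oz0 sz0] [<- <- Oz1 sz1]; split => // i iN.
  by apply: convex_set_comb => //; [exact: Oz0 | exact: Oz1].
have Oi0 := Oz0 i (ltnW iN); have Oi1 := Oz1 i (ltnW iN).
have := boundary_dist_concave Hdom Hconv Oi0 Oi1 s01.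
move=> /(ler_wpM2l r0); apply: le_trans.
rewrite opprD addrACA -!scalerBr; apply: (le_trans (ler_normD _ _)).
move: s01 => /andP[s0 s1]; have s1' : 0 <= 1 - s by rewrite subr_ge0.
rewrite !normrZ !ger0_norm// mulrDr !(mulrCA r).
by apply: lerD; apply: ler_wpM2l; rewrite ?sz0 ?sz1.
Qed.

End chains.

(** * Length of curves *)

Section curve_length_theory.
Context {R : realType} {X : completeNormedModType R}.
Implicit Types (gam : R -> X) (a b c t : R) (s : seq R).

Lemma polygonal_length_nil gam a b : polygonal_length gam a b [::] = 0.
Proof. by rewrite /polygonal_length big_geq. Qed.

Lemma polygonal_length_cons gam a b c s :
  polygonal_length gam a b (c :: s) =
  `|gam c - gam a| + polygonal_length gam c b s.
Proof. by rewrite /polygonal_length big_nat_recl. Qed.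

Lemma itv_partition_consE a b c s :
  itv_partition a b (c :: s) <-> a < c /\ itv_partition c b s.
Proof.
by split=> [[/= /andP[ac p] l]|[ac [p l]]]; split => //; rewrite /= ?ac.
Qed.

Lemma polygonal_length_cat gam a b c s1 s2 :
  itv_partition a c s1 -> itv_partition c b s2 ->
  polygonal_length gam a b (s1 ++ s2) =
  polygonal_length gam a c s1 + polygonal_length gam c b s2.
Proof.
elim: s1 a => [a /itv_partition_nil -> _|e s1 IH a /itv_partition_consE[_ es] cs].
  by rewrite polygonal_length_nil add0r.
by rewrite cat_cons !polygonal_length_cons IH// addrA.
Qed.

Lemma polygonal_length_split gam a b c s : itv_partition a b s -> a <= c <= b ->
  exists s1 s2, [/\ itv_partition a c s1, itv_partition c b s2 &
    polygonal_length gam a b s <=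
      polygonal_length gam a c s1 + polygonal_length gam c b s2].
Proof.
elim: s a => [|e s IH] a.
  move=> /itv_partition_nil -> /le_anti ->; exists [::], [::]; split => //.
  by rewrite !polygonal_length_nil addr0.
move=> /itv_partition_consE[ae es] /andP[ac cb].
have [ec|ce] := leP e c.
  have [|s1 [s2 [p1 p2 le12]]] := IH e es; first by rewrite ec.
  exists (e :: s1), s2; split => //; first exact/itv_partition_consE.
  by rewrite !polygonal_length_cons -addrA lerD2l.
move: ac; rewrite le_eqVlt => /orP[/eqP <-|ac].
  exists [::], (e :: s); split => //; first exact/itv_partition_consE.
  by rewrite polygonal_length_nil add0r.
exists [:: c], (e :: s); split; [exact: itv_partition1|exact/itv_partition_consE|].
rewrite !polygonal_length_cons polygonal_length_nil addr0 addrA lerD2r.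
by rewrite addrC [leRHS]addrC (addrC (`|gam c - _|)) ler_distD.
Qed.

Local Notation V := curve_length.
Local Open Scope ereal_scope.

Lemma polygonal_length_le gam a b s : itv_partition a b s ->
  (polygonal_length gam a b s)%:E <= V gam a b.
Proof. by move=> ps; apply: ereal_sup_ubound; exists s. Qed.

Lemma curve_length_le gam a b (M : \bar R) :
  (forall s, itv_partition a b s -> (polygonal_length gam a b s)%:E <= M) ->
  V gam a b <= M.
Proof. by move=> H; apply: ub_ereal_sup => _ [s ps <-]; exact: H. Qed.

Lemma curve_length_dist gam a b : (a <= b)%R -> (`|gam b - gam a|)%:E <= V gam a b.
Proof.
rewrite le_eqVlt => /orP[/eqP <-|ab].
  rewrite subrr normr0 -(polygonal_length_nil gam a a).
  by apply: polygonal_length_le.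
rewrite -(addr0 `|_|%R) -(polygonal_length_nil gam b b) -polygonal_length_cons.
exact/polygonal_length_le/itv_partition1.
Qed.

Lemma curve_length_ge0 gam a b : (a <= b)%R -> 0 <= V gam a b.
Proof. by move=> ab; apply: le_trans (curve_length_dist gam ab); rewrite lee_fin. Qed.

Lemma curve_lengthD gam a b c : (a <= c <= b)%R ->
  V gam a b = V gam a c + V gam c b.
Proof.
move=> /andP[ac cb]; have V1 := curve_length_ge0 gam ac; have V2 := curve_length_ge0 gam cb.
apply/le_anti/andP; split.
  apply: curve_length_le => s ps.
  have [|s1 [s2 [p1 p2 le12]]] := polygonal_length_split gam (c := c) ps; first by rewrite ac.
  apply: (@le_trans _ _ (polygonal_length gam a c s1 + polygonal_length gam c b s2)%R%:E).
    by rewrite lee_fin.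
  by rewrite EFinD leeD// polygonal_length_le.
have [Voo|Vfin] := eqVneq (V gam a b) +oo; first by rewrite Voo leey.
have H s1 s2 : itv_partition a c s1 -> itv_partition c b s2 ->
    (polygonal_length gam a c s1)%:E + (polygonal_length gam c b s2)%:E <= V gam a b.
  move=> p1 p2; rewrite -EFinD -polygonal_length_cat//.
  exact/polygonal_length_le/itv_partition_cat/p2.
have H1 s2 : itv_partition c b s2 ->
    V gam a c + (polygonal_length gam c b s2)%:E <= V gam a b.
  move=> p2; rewrite -leeBrDr//; apply: curve_length_le => s1 p1.
  by rewrite leeBrDr// H.
have V1fin : V gam a c \is a fin_num.
  rewrite ge0_fin_numE// ltey; apply/eqP => V1oo.
  move: Vfin; rewrite -leye_eq => /negP; apply.
  have [s2 p2] : exists s2, itv_partition c b s2.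
    move: cb; rewrite le_eqVlt => /orP[/eqP <-|cb]; first by exists [::].
    by exists [:: b]; exact: itv_partition1.
  by apply: le_trans (H1 s2 p2); rewrite V1oo addye.
rewrite addeC -leeBrDr//; apply: curve_length_le => s2 p2.
by rewrite leeBrDr// addeC H1.
Qed.

Lemma curve_length_lipschitz gam a b (M : R) :
  (forall u t, a <= u -> u <= t -> t <= b -> `|gam t - gam u| <= M * (t - u))%R ->
  V gam a b <= (M * (b - a))%:E.
Proof.
move=> H; apply: curve_length_le => s ps; rewrite lee_fin.
elim: s a H ps => [|e s IH] a H.
  by move=> /itv_partition_nil ->; rewrite polygonal_length_nil subrr mulr0.
move=> /itv_partition_consE[ae es]; have eb := itv_partition_le es.
rewrite polygonal_length_cons.
have -> : (M * (b - a) = M * (e - a) + M * (b - e))%R by ring.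
apply: lerD; first by apply: H => //; exact: ltW.
by apply: IH => // u v eu; apply: H; apply: le_trans eu; exact: ltW.
Qed.

(** Only the last segment of the partition ends at [b]; for a curve that is
    continuous at [b] this gives left continuity of the length. *)
Lemma polygonal_length_last gam a b s : itv_partition a b s -> (a < b)%R ->
  exists2 c, (a <= c < b)%R &
    (polygonal_length gam a b s)%:E <= V gam a c + (`|gam b - gam c|)%:E.
Proof.
elim: s a => [a /itv_partition_nil -> |e s IH a /itv_partition_consE[ae es] ab].
  by rewrite ltxx.
have := itv_partition_le es; rewrite le_eqVlt => /orP[/eqP eb|eb].
  exists a; rewrite ?lexx//; move: es; rewrite eb => /itv_partitionxx ->.
  rewrite polygonal_length_cons polygonal_length_nil addr0 leeDr//.
  exact: curve_length_ge0.
have [c /andP[ec cb] Hc] := IH e es eb; exists c; first by rewrite cb (le_trans (ltW ae)).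
rewrite polygonal_length_cons EFinD (@curve_lengthD gam a c e); last by rewrite ec ltW.
by rewrite -addeA leeD// curve_length_dist// ltW.
Qed.

Lemma polygonal_length_first gam a b s : itv_partition a b s -> (a < b)%R ->
  exists2 c, (a < c <= b)%R &
    (polygonal_length gam a b s)%:E <= (`|gam c - gam a|)%:E + V gam c b.
Proof.
case: s => [/itv_partition_nil -> |e s /itv_partition_consE[ae es] ab].
  by rewrite ltxx.
exists e; first by rewrite ae (itv_partition_le es).
by rewrite polygonal_length_cons EFinD leeD2l// polygonal_length_le.
Qed.

End curve_length_theory.

Section within_continuity.
Context {R : realType} {Y : normedModType R}.

Lemma within_itv_continuousP (a b : R) (f : R -> Y) :
  {within `[a, b], continuous f} <->
  forall t e, a <= t <= b -> 0 < e -> exists2 d, 0 < d &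
    forall u, a <= u <= b -> `|u - t| < d -> `|f u - f t| < e.
Proof.
rewrite subspace_continuousP; split=> [cf t e tab e0|H t].
  have /cvgrPdist_lt/(_ e e0) := cf t ltac:(by rewrite /= in_itv).
  rewrite near_withinE => /nbhs_ballP[d /= d0 dP]; exists d => // u uab ut.
  rewrite distrC; apply: dP; last by rewrite /= in_itv.
  by rewrite -ball_normE /ball_ /= distrC.
rewrite /= in_itv /= => tab; apply/cvgrPdist_lt => e e0.
have [d d0 dP] := H t e tab e0; rewrite near_withinE; apply/nbhs_ballP.
exists d => //= u; rewrite -ball_normE /ball_ /= distrC => ut.
by rewrite in_itv /= => uab; rewrite distrC dP.
Qed.

End within_continuity.

(** * Parametrization by arc length *)

Section arc_length.
Context {R : realType} {X : completeNormedModType R} (gam : R -> X).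
Hypothesis rgam : rectifiable gam.
Implicit Types (s t u e : R).

Definition arc_length t : R := fine (curve_length gam 0 t).
Local Notation v := arc_length.

Lemma curve_length_fin s t : 0 <= s -> s <= t -> t <= 1 ->
  curve_length gam s t = (v t - v s)%:E.
Proof.
move=> s0 st t1; have t0 := le_trans s0 st.
have fin0 u : 0 <= u <= 1 -> curve_length gam 0 u \is a fin_num.
  move=> u01; move: (u01) => /andP[u0 u1]; rewrite ge0_fin_numE ?curve_length_ge0//.
  apply: le_lt_trans rgam.2; rewrite (curve_lengthD gam u01).
  by rewrite leeDl// curve_length_ge0.
have f0 := fin0 t ltac:(by rewrite t0).
have f1 := fin0 s ltac:(by rewrite s0 (le_trans st)).
rewrite EFinB /v !fineK// (@curve_lengthD _ _ gam 0 t s) ?s0//.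
by rewrite addeAC subee// add0e.
Qed.

Lemma arc_length0 : v 0 = 0.
Proof.
suff : curve_length gam 0 0 = 0%E by rewrite /v => ->.
apply/eqP; rewrite eq_le curve_length_ge0// andbT.
apply: curve_length_le => s /itv_partitionxx ->.
by rewrite polygonal_length_nil.
Qed.

Lemma arc_length_dist s t : 0 <= s -> s <= t -> t <= 1 ->
  `|gam t - gam s| <= v t - v s.
Proof.
by move=> s0 st t1; rewrite -lee_fin -curve_length_fin// curve_length_dist.
Qed.

Lemma arc_length_le s t : 0 <= s -> s <= t -> t <= 1 -> v s <= v t.
Proof.
by move=> s0 st t1; rewrite -subr_ge0; apply: le_trans (arc_length_dist s0 st t1).
Qed.

Let cgam := (within_itv_continuousP 0 1 gam).1 rgam.1.

Let right_cont t e : 0 <= t < 1 -> 0 < e -> exists2 d, 0 < d &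
  forall u, t <= u <= 1 -> u < t + d -> v u - v t < e.
Proof.
move=> /andP[t0 t1] e0.
have [d d0 dP] := cgam (t := t) (e := e / 2) ltac:(lra) ltac:(lra).
have : (curve_length gam t 1 - (e / 2)%:E < curve_length gam t 1)%E.
  by rewrite curve_length_fin ?(ltW t1)// -EFinB lte_fin; lra.
move=> /ereal_sup_gt[_ [s ps <-] sgt].
have [c /andP[tc c1] cP] := polygonal_length_first gam ps t1.
exists (Num.min d (c - t)); first by rewrite lt_min d0 subr_gt0.
move=> u /andP[tu u1]; rewrite -ltrBlDl lt_min => /andP[ud uc].
have := lt_le_trans sgt cP.
have c0 : 0 <= c by lra.
rewrite (curve_length_fin t0 (ltW t1))// (curve_length_fin c0 c1)//.
rewrite -EFinB -EFinD lte_fin.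
have g1 := dP u ltac:(lra) ltac:(by rewrite ger0_norm; lra).
have g2 := @arc_length_dist u c ltac:(lra) ltac:(lra) c1.
have := ler_distD (gam u) (gam c) (gam t); lra.
Qed.

Let left_cont t e : 0 < t <= 1 -> 0 < e -> exists2 d, 0 < d &
  forall u, 0 <= u <= t -> t - d < u -> v t - v u < e.
Proof.
move=> /andP[t0 t1] e0.
have [d d0 dP] := cgam (t := t) (e := e / 2) ltac:(lra) ltac:(lra).
have : (curve_length gam 0 t - (e / 2)%:E < curve_length gam 0 t)%E.
  by rewrite curve_length_fin ?(ltW t0)// -EFinB lte_fin; lra.
move=> /ereal_sup_gt[_ [s ps <-] sgt].
have [c /andP[c0 ct] cP] := polygonal_length_last gam ps t0.
exists (Num.min d (t - c)); first by rewrite lt_min d0 subr_gt0.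
move=> u /andP[u0 ut]; rewrite ltrBlDr -ltrBlDl lt_min => /andP[ud uc].
have := lt_le_trans sgt cP.
have c1 : c <= 1 by lra.
rewrite (curve_length_fin (lexx 0) (ltW t0) t1) (curve_length_fin (lexx 0) c0 c1).
rewrite -EFinB -EFinD lte_fin.
have g1 := dP u ltac:(lra) ltac:(by rewrite distrC ger0_norm; lra).
have g2 := @arc_length_dist c u c0 ltac:(lra) ltac:(lra).
have := ler_distD (gam u) (gam t) (gam c); rewrite (distrC (gam t) (gam u)).
rewrite arc_length0; lra.
Qed.

(** If a partition of the interval that starts (or ends) at [t] is optimal up
    to [e / 2], then cutting off a piece of its extreme segment at which the
    curve has moved by less than [e / 2] removes at most [e] from the length. *)
Lemma arc_length_continuous : {within `[0, 1], continuous v}.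
Proof.
apply/within_itv_continuousP => t e /andP[t0 t1] e0.
have [d1 d10 P1] : exists2 d, 0 < d & forall u, t <= u <= 1 -> u < t + d -> v u - v t < e.
  have [tE|tn] := eqVneq t 1.
    by exists 1 => // u; rewrite tE => /le_anti ->; rewrite subrr.
  by apply: right_cont => //; rewrite t0 lt_neqAle tn.
have [d2 d20 P2] : exists2 d, 0 < d & forall u, 0 <= u <= t -> t - d < u -> v t - v u < e.
  have [tE|tn] := eqVneq t 0.
    by exists 1 => // u; rewrite tE => /le_anti <-; rewrite subrr.
  by apply: left_cont => //; rewrite t1 andbT lt_neqAle eq_sym tn.
exists (Num.min d1 d2); first by rewrite lt_min d10.
move=> u /andP[u0 u1]; rewrite lt_min !ltr_norml => /andP[/andP[a1 a2] /andP[b1 b2]].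
have [ut|tu] := leP u t.
- have := P2 u ltac:(lra) ltac:(lra); have := arc_length_le u0 ut t1; lra.
- have := P1 u ltac:(lra) ltac:(lra); have := arc_length_le t0 (ltW tu) u1; lra.
Qed.

Lemma arc_length_surj_in a b s : 0 <= a -> a <= b -> b <= 1 ->
  v a <= s <= v b -> exists2 t, a <= t <= b & v t = s.
Proof.
move=> a0 ab b1 /andP[as0 sb].
have cv : {within `[a, b], continuous v}.
  apply: continuous_subspaceW arc_length_continuous => t /=.
  by rewrite !in_itv /= => /andP[at_ tb]; rewrite (le_trans a0)//= (le_trans tb).
have [|c] := IVT ab cv (v := s).
  by rewrite ge_min as0 le_max sb orbT.
by rewrite in_itv /= => cab vc; exists c.
Qed.

Lemma arc_length_surj s : 0 <= s <= v 1 -> exists2 t, 0 <= t <= 1 & v t = s.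
Proof. by move=> s01; apply: arc_length_surj_in; rewrite ?arc_length0. Qed.

Local Notation sigma := (arc_length_param gam).

(** The point picked in [arc_length_param] need not be [gam t], but the curve
    does not move between two parameters of equal arc length. *)
Lemma arc_length_paramE t : 0 <= t <= 1 -> sigma (v t) = gam t.
Proof.
move=> /andP[t0 t1].
have fE u : 0 <= u <= 1 -> curve_length gam 0 u = (v u)%:E.
  by move=> /andP[u0 u1]; rewrite curve_length_fin// arc_length0 subr0.
have := @xgetPex _ 0 [set u | `[0, 1]%classic u /\ curve_length gam 0 u = (v t)%:E].
move=> [|/=].
  by exists t; split; [rewrite /= in_itv /= t0 | rewrite fE ?t0].
rewrite -/(sigma (v t)) /arc_length_param; set u := xget _ _; rewrite in_itv /=.
move=> [u01]; rewrite fE// => -[vut]; move: u01 => /andP[u0 u1].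
apply/eqP; rewrite -subr_eq0 -normr_le0.
have [tu|ut] := leP t u.
  by apply: le_trans (arc_length_dist t0 tu u1) _; rewrite vut subrr.
by rewrite distrC; apply: le_trans (arc_length_dist u0 (ltW ut) t1) _; rewrite vut subrr.
Qed.

Lemma arc_length_param_lip s s' : 0 <= s -> s <= s' -> s' <= v 1 ->
  `|sigma s' - sigma s| <= s' - s.
Proof.
move=> s0 ss' s'1.
have [t /andP[t0 t1] tE] := @arc_length_surj s ltac:(lra).
have [t' /andP[t'0 t'1] tE'] := @arc_length_surj s' ltac:(lra).
rewrite -tE -tE' !arc_length_paramE ?t0 ?t'0//.
have [tt'|t't] := leP t t'; first exact: arc_length_dist.
have : v t' <= v t by apply: arc_length_le => //; exact: ltW.
move=> vtt; have E : v t = v t' by lra.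
by rewrite E subrr distrC; have := arc_length_dist t'0 (ltW t't) t1; rewrite E subrr.
Qed.

End arc_length.

(** * Line integrals and chains *)

Section interval_integral.
Context {R : realType} (g : R -> R) (l : R).
Hypothesis mg : measurable_fun (`[0, l]%classic : set R) (EFin \o g).
Hypothesis g0 : forall s, 0 <= s <= l -> 0 <= g s.

Definition integral_from0 (b : R) : \bar R :=
  (\int[lebesgue_measure]_(s in `[0%R, b]%classic) (g s)%:E)%E.

Let tail (a b : R) : \bar R :=
  (\int[lebesgue_measure]_(s in `]a, b]%classic) (g s)%:E)%E.

Let sub_itv (a b : R) : 0 <= a -> b <= l -> `]a, b]%classic `<=` `[0, l]%classic.
Proof.
move=> a0 bl s /=; rewrite !in_itv /= => /andP[as0 sb].
by rewrite (le_trans sb bl) andbT ltW// (le_lt_trans a0).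
Qed.

Let integral_from0_split (a b : R) : 0 <= a -> a <= b -> b <= l ->
  integral_from0 b = (integral_from0 a + tail a b)%E.
Proof.
move=> a0 ab bl; rewrite /integral_from0 /tail.
have E : `[0, b]%classic = `[0, a]%classic `|` `]a, b]%classic.
  by apply: itv_bndbnd_setU; rewrite bnd_simp.
rewrite E ge0_integral_setU//=.
- rewrite -E; apply: measurable_funS mg => // s /=; rewrite !in_itv /=.
  by move=> /andP[-> sb]; exact: le_trans bl.
- move=> s H; have : (`[0, b]%classic : set R) s by rewrite E.
  rewrite /= in_itv /= => /andP[s0 sb]; rewrite lee_fin g0// s0.
  exact: le_trans bl.
- apply/disj_setPRL => s /=; rewrite !in_itv /= => /andP[as0 _] /andP[_].
  by rewrite leNgt as0.
Qed.

Let cst_tail (a b c : R) : a <= b ->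
  (\int[lebesgue_measure]_(s in `]a, b]%classic) c%:E)%E = (c * (b - a))%:E.
Proof.
move=> ab; rewrite integral_cst//= lebesgue_measure_itv /= lte_fin.
move: ab; rewrite le_eqVlt => /orP[/eqP ->|ab]; last by rewrite ab -EFinB -EFinM.
by rewrite ltxx subrr mulr0 mule0.
Qed.

Lemma integral_from0_lower (a b c : R) : 0 <= a -> a <= b -> b <= l -> 0 <= c ->
  (forall s, a <= s <= b -> c <= g s) ->
  (integral_from0 a + (c * (b - a))%:E <= integral_from0 b)%E.
Proof.
move=> a0 ab bl c0 cg; rewrite (integral_from0_split a0 ab bl) leeD2l// -cst_tail//.
apply: ge0_le_integral => //=.
- exact: measurable_funS (sub_itv a0 bl) mg.
- by move=> s; rewrite in_itv /= => /andP[as0 sb]; rewrite lee_fin cg// ltW.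
Qed.

Lemma integral_from0_upper (a b c : R) : 0 <= a -> a <= b -> b <= l ->
  (forall s, a <= s <= b -> g s <= c) ->
  (integral_from0 b <= integral_from0 a + (c * (b - a))%:E)%E.
Proof.
move=> a0 ab bl gc; rewrite (integral_from0_split a0 ab bl) leeD2l// -cst_tail//.
apply: ge0_le_integral => //=.
- move=> s; rewrite in_itv /= => /andP[as0 sb]; rewrite lee_fin g0//.
  by rewrite ltW/= ?(le_trans sb)// (le_lt_trans a0).
- exact: measurable_funS (sub_itv a0 bl) mg.
- by move=> s; rewrite in_itv /= => /andP[as0 sb]; rewrite lee_fin gc// ltW.
Qed.

Lemma integral_from0_0 : integral_from0 0 = 0%E.
Proof. by rewrite /integral_from0 set_itv1 integral_set1. Qed.

Lemma integral_from0_le (a b : R) : 0 <= a -> a <= b -> b <= l -> (integral_from0 a <= integral_from0 b)%E.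
Proof.
move=> a0 ab bl; have := integral_from0_lower a0 ab bl (lexx 0).
rewrite mul0r adde0; apply => s /andP[as0 sb].
by rewrite g0// (le_trans a0)//= (le_trans sb).
Qed.

End interval_integral.

Section curves_and_chains.
Context {R : realType} {X : completeNormedModType R} (Omega : set X).
Hypothesis Hdom : domain Omega.
Local Notation d := (boundary_dist Omega).
Local Notation invd := (fun z => (d z)^-1).

Section curve.
Variables (gam : R -> X) (x y : X).
Hypotheses (rgam : rectifiable gam) (cgam : curve_in Omega x y gam).
Local Notation v := (arc_length gam).
Local Notation sigma := (arc_length_param gam).
Local Notation g := (fun s => (d (sigma s))^-1).

Let gam_in t : 0 <= t <= 1 -> Omega (gam t).
Proof. by case: cgam => _ + _ _ t01; apply; exists t => //=; rewrite in_itv. Qed.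

Lemma arc_length_param_in s : 0 <= s <= v 1 -> Omega (sigma s).
Proof.
by move=> /(arc_length_surj rgam)[t t01 <-]; rewrite arc_length_paramE//; exact: gam_in.
Qed.

Lemma arc_length_param_measurable :
  measurable_fun (`[0, v 1]%classic : set R) (EFin \o g).
Proof.
apply/measurable_EFinP; apply: subspace_continuous_measurable_fun => //.
have cd : {within `[0, v 1], continuous (d \o sigma : R -> R^o)}.
  apply/(@within_itv_continuousP _ R^o) => t e /andP[t0 t1] e0; exists e => // u /andP[u0 u1] ut.
  apply: le_lt_trans ut; rewrite /= ler_norml.
  have e1 := boundary_dist_lip Hdom (sigma t) (sigma u).
  have e2 := boundary_dist_lip Hdom (sigma u) (sigma t).
  have [tu|/ltW tu] := leP t u.
    have := arc_length_param_lip rgam t0 tu u1; rewrite (distrC (sigma t)) in e1.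
    by rewrite (@ger0_norm _ (u - t)) ?subr_ge0//; lra.
  have := arc_length_param_lip rgam u0 tu t1; rewrite (distrC (sigma u)) in e2.
  by rewrite (@ler0_norm _ (u - t)) ?subr_le0//; lra.
apply/subspace_continuousP => t t01; apply: cvgV.
  move: t01; rewrite /= in_itv /= => /arc_length_param_in Ot.
  by rewrite gt_eqF// (boundary_dist_gt0 Hdom).
by move: cd => /subspace_continuousP; apply.
Qed.

Lemma boundary_dist_inv_ge0 s : 0 <= s <= v 1 -> 0 <= g s.
Proof. by move=> /arc_length_param_in /(boundary_dist_gt0 Hdom)/ltW; rewrite invr_ge0. Qed.

Lemma line_integralE :
  line_integral gam invd = integral_from0 g (v 1).
Proof. by []. Qed.

Let mg := arc_length_param_measurable.
Let g0 := boundary_dist_inv_ge0.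

(** A greedy walk along the curve by arc length: from [s], advance by [r] times
    the distance of the current point to the boundary.  Each full step costs at
    least [r / (1 + r)] of the line integral, so that the walk reaches the end in
    at most [L * (1 + r) / r + 1] steps. *)
Lemma chain_of_curve (L r : R) : 0 < r ->
  (line_integral gam invd < L%:E)%E ->
  exists N z, N%:R * r <= L * (1 + r) + r /\ qh_chain Omega r N x y z.
Proof.
move=> r0; rewrite line_integralE => IL; set l := v 1 in IL *.
have l0 : 0 <= l by rewrite -(arc_length0 gam) arc_length_le.
have L0 : 0 < L.
  have := integral_from0_le mg g0 (lexx 0) l0 (lexx _).
  by rewrite integral_from0_0 => /le_lt_trans/(_ IL); rewrite lte_fin.
have [s [s00 sE']] : exists s : nat -> R, s 0%N = 0 /\
    forall n, s n.+1 = Num.min l (s n + r * d (sigma (s n))).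
  by exists (fix s n := if n is m.+1
    then Num.min l (s m + r * d (sigma (s m))) else 0).
have s01 n : 0 <= s n <= l.
  elim: n => [|n IH]; first by rewrite s00 lexx l0.
  have dn := boundary_dist_gt0 Hdom (arc_length_param_in IH).
  move: (IH) => /andP[sn0 _].
  by rewrite sE' ge_min lexx andbT le_min l0 addr_ge0// mulr_ge0// ltW.
have dn n := boundary_dist_gt0 Hdom (arc_length_param_in (s01 n)).
have sS n : s n <= s n.+1.
  have /andP[_ sl] := s01 n.
  by rewrite sE' le_min sl lerDl mulr_ge0// ltW.
have sr n : s n.+1 - s n <= r * d (sigma (s n)).
  by rewrite lerBlDl sE' ge_min lexx orbT.
have grow n : s n < l -> ((n%:R * (r / (1 + r)))%:E <= integral_from0 g (s n))%E.
  elim: n => [|n IH] snl; first by rewrite mul0r s00 integral_from0_0.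
  have snl' : s n < l by apply: le_lt_trans snl.
  have sE : s n.+1 = s n + r * d (sigma (s n)).
    by move: snl; rewrite sE' gt_min ltxx /= => /ltW/min_idPr.
  have /andP[sn0 _] := s01 n.
  have r1 : 0 < 1 + r by rewrite addr_gt0.
  have D0 : 0 < d (sigma (s n)) * (1 + r) by rewrite mulr_gt0.
  have := @integral_from0_lower _ g l mg g0 (s n) (s n.+1) (d (sigma (s n)) * (1 + r))^-1
    sn0 (sS n) (ltW snl).
  move=> H; apply: le_trans (H _ _); last 2 first.
  - by rewrite invr_ge0 ltW.
  - move=> u /andP[u1 u2].
    have ul : 0 <= u <= l by apply/andP; split; [exact: le_trans u1 | apply: le_trans u2 _; exact: ltW].
    rewrite lef_pV2 ?posrE//; last exact: boundary_dist_gt0 (arc_length_param_in ul).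
    have ul2 : u <= v 1 by case/andP: ul.
    have := arc_length_param_lip rgam sn0 u1 ul2.
    have := boundary_dist_lip Hdom (sigma u) (sigma (s n)).
    move=> h1 h2; apply: (le_trans h1); rewrite mulrDr mulr1 lerD2l [leRHS]mulrC.
    by apply: (le_trans h2); apply: le_trans (sr n); rewrite lerD2r.
  have -> : (d (sigma (s n)) * (1 + r))^-1 * (s n.+1 - s n) = r / (1 + r).
    rewrite sE addrAC subrr add0r mulrC (mulrC r) -mulf_div divff ?mul1r//.
    by rewrite gt_eqF.
  by rewrite -natr1 mulrDl mul1r EFinD leeD2r// IH.
pose N := (Num.truncn (L * (1 + r) / r)).+1.
have r1 : 0 < 1 + r by rewrite addr_gt0.
have Lr0 : 0 <= L * (1 + r) / r by rewrite divr_ge0 ?mulr_ge0 ?(ltW L0) ?(ltW r0) ?(ltW r1).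
have NL : L * (1 + r) / r < N%:R by exact: truncnS_gt.
have NU : N%:R <= L * (1 + r) / r + 1 by rewrite /N -natr1 lerD2r truncn_le.
have sN : s N = l.
  have /andP[_] := s01 N; rewrite le_eqVlt => /orP[/eqP//|snl].
  have := grow N snl; have := integral_from0_le mg g0 (proj1 (andP (s01 N))) (ltW snl) (lexx _).
  move=> a b; have := le_lt_trans (le_trans b a) IL; rewrite lte_fin.
  move: NL; rewrite ltr_pdivrMr// => c; rewrite mulrA ltr_pdivrMr// => /lt_trans/(_ c).
  by rewrite ltxx.
exists N, (fun n => sigma (s n)); split.
  have := ler_pM2r r0 N%:R (L * (1 + r) / r + 1); rewrite NU => /idP.
  by rewrite mulrDl divfK ?gt_eqF// mul1r.
have [_ _ gx gy] := cgam.
split => //.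
- by rewrite s00 -(arc_length0 gam) arc_length_paramE ?lexx ?ler01.
- by rewrite sN /l arc_length_paramE ?lexx ?ler01.
- by move=> i _; exact: arc_length_param_in.
- move=> i _; apply: le_trans (sr i).
  by apply: arc_length_param_lip => //; [case/andP: (s01 i) | case/andP: (s01 i.+1)].
Qed.

(** On the piece from [t i] to [t i.+1] the integrand is at most [(D i)^-1], and
    the length is at most [c * D i]. *)
Lemma line_integral_le_pieces (N : nat) (t : nat -> R) (c : R) (D : nat -> R) :
  t 0%N = 0 -> t N = 1 -> 0 <= c ->
  (forall i, (i < N)%N -> [/\ 0 <= t i, t i <= t i.+1, t i.+1 <= 1,
    0 < D i /\ v (t i.+1) - v (t i) <= c * D i &
    forall u, t i <= u <= t i.+1 -> D i <= d (gam u)]) ->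
  (line_integral gam invd <= (N%:R * c)%:E)%E.
Proof.
move=> t0 tN c0 H; rewrite line_integralE.
suff : forall i, (i <= N)%N -> (integral_from0 g (v (t i)) <= (i%:R * c)%:E)%E.
  by move=> /(_ N (leqnn N)); rewrite tN.
elim=> [|i IH] iN; first by rewrite t0 arc_length0 integral_from0_0 mul0r.
have [ti0 tii ti1 [Di0 vD] dD] := H i iN.
have v0 : 0 <= v (t i).
  by rewrite -(arc_length0 gam) arc_length_le// (le_trans tii).
have vv : v (t i) <= v (t i.+1) by rewrite arc_length_le.
have v1 : v (t i.+1) <= v 1 by rewrite arc_length_le// (le_trans ti0).
have := integral_from0_upper mg g0 (c := (D i)^-1) v0 vv v1.
move=> /(_ _) G; apply: le_trans (G _) _.
  move=> s /(arc_length_surj_in rgam ti0 tii ti1)[u /andP[u1 u2] <-].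
  have u01 : 0 <= u <= 1 by rewrite (le_trans ti0)//= (le_trans u2).
  rewrite arc_length_paramE//.
  have du : D i <= d (gam u) by apply: dD; rewrite u1.
  by rewrite lef_pV2// posrE (lt_le_trans Di0).
rewrite -natr1 mulrDl mul1r EFinD leeD ?IH ?(ltnW iN)// lee_fin.
by rewrite mulrC ler_pdivrMr.
Qed.

End curve.
End curves_and_chains.

(** * Chains as polygons *)

Section polygons.
Context {R : realType} {X : completeNormedModType R}.

Definition clamp (u : R) : R := Num.max 0 (Num.min 1 u).

Lemma clamp_le0 u : u <= 0 -> clamp u = 0.
Proof. by move=> u0; apply/max_idPl; rewrite ge_min u0 orbT. Qed.

Lemma clamp_ge1 u : 1 <= u -> clamp u = 1.
Proof. by move=> u1; rewrite /clamp (min_idPl u1); apply/max_idPr. Qed.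

Lemma clamp_id u : 0 <= u <= 1 -> clamp u = u.
Proof. by move=> /andP[u0 u1]; rewrite /clamp (min_idPr u1); apply/max_idPr. Qed.

Lemma clamp_lip a b : `|clamp a - clamp b| <= `|a - b|.
Proof.
wlog ab : a b / a <= b => [H|].
  by have [/H//|/ltW/H] := leP a b; rewrite distrC (distrC b).
rewrite (distrC a) (ger0_norm (_ : 0 <= b - a)) ?subr_ge0//.
have [a0|a0] := leP a 0; have [b1|b1] := leP 1 b.
- by rewrite clamp_le0// clamp_ge1// sub0r normrN normr1; lra.
- rewrite clamp_le0// sub0r normrN; have [b0|b0] := leP b 0.
    by rewrite clamp_le0// normr0 subr_ge0.
  have -> : clamp b = b by apply: clamp_id; lra.
  by rewrite ger0_norm; lra.
- rewrite (clamp_ge1 b1); have [a1|a1] := leP 1 a.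
    by rewrite clamp_ge1// subrr normr0 subr_ge0.
  have -> : clamp a = a by apply: clamp_id; lra.
  by rewrite ler0_norm; lra.
- have -> : clamp a = a by apply: clamp_id; lra.
  have -> : clamp b = b by apply: clamp_id; lra.
  by rewrite ler0_norm; lra.
Qed.

Variables (N : nat) (z : nat -> X).

(** The polygon through [z 0, ..., z N], at the vertex [z i] at time [i]; with
    a closed formula its Lipschitz continuity is immediate. *)
Definition polygon (u : R) : X :=
  z 0%N + \sum_(0 <= j < N) clamp (u - j%:R) *: (z j.+1 - z j).

Lemma polygon_piece i u : (i < N)%N -> i%:R <= u <= i.+1%:R ->
  polygon u = z i + (u - i%:R) *: (z i.+1 - z i).
Proof.
move=> iN /andP[iu ui]; rewrite /polygon (big_cat_nat (n := i))//=; last exact: ltnW.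
rewrite [X in _ + (_ + X)]big_ltn// [X in _ + (_ + (_ + X))]big1_seq; last first.
  move=> j /andP[_]; rewrite mem_index_iota => /andP[ij _].
  rewrite clamp_le0 ?scale0r// subr_le0; apply: le_trans ui _.
  by rewrite ler_nat.
rewrite (@eq_big_nat _ _ _ 0 i _ (fun j => z j.+1 - z j)); last first.
  move=> j /andP[_ ji]; rewrite clamp_ge1 ?scale1r// lerBrDr.
  by apply: le_trans iu; rewrite addrC natr1 ler_nat.
rewrite telescope_sumr// addr0 addrA [z 0%N + _]addrC subrK clamp_id//.
by rewrite subr_ge0 iu lerBlDl natr1.
Qed.

Lemma polygon_lip u w :
  `|polygon u - polygon w| <= (\sum_(0 <= j < N) `|z j.+1 - z j|) * `|u - w|.
Proof.
rewrite /polygon opprD addrACA subrr add0r -sumrB.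
apply: (le_trans (ler_norm_sum _ _ _)); rewrite mulr_suml; apply: ler_sum => j _.
rewrite -scalerBl normrZ mulrC ler_wpM2l//; apply: (le_trans (clamp_lip _ _)).
by rewrite opprB addrA subrK.
Qed.

End polygons.

Section quasihyperbolic_chains.
Context {R : realType} {X : completeNormedModType R} (Omega : set X).
Hypothesis Hdom : domain Omega.
Local Notation d := (boundary_dist Omega).
Local Notation invd := (fun z => (d z)^-1).

Lemma curve_of_chain_pos (r : R) N x y z : 0 <= r < 1 -> (0 < N)%N ->
  qh_chain Omega r N x y z ->
  exists gam, [/\ rectifiable gam, curve_in Omega x y gam &
    (line_integral gam invd <= (N%:R * (r / (1 - r)))%:E)%E].
Proof.
move=> /andP[r0 r1] N0 [zx zy Oz sz].
have NR : 0 < N%:R :> R by rewrite ltr0n.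
pose gam (t : R) := polygon N z (N%:R * t).
pose M := (\sum_(0 <= j < N) `|z j.+1 - z j|) * N%:R.
have M0 : 0 <= M by rewrite mulr_ge0// sumr_ge0.
have gM t u : `|gam t - gam u| <= M * `|t - u|.
  apply: (le_trans (polygon_lip _ _ _ _)).
  by rewrite -mulrBr normrM ger0_norm// mulrA.
have cg : {within `[0, 1], continuous gam}.
  apply/within_itv_continuousP => t e _ e0; exists (e / (M + 1)).
    by rewrite divr_gt0// ltr_wpDl.
  move=> u _; rewrite ltr_pdivlMr ?ltr_wpDl// => ut.
  apply: (le_lt_trans (gM _ _)); apply: le_lt_trans ut.
  by rewrite mulrC ler_wpM2l// lerDl.
have rg : rectifiable gam.
  split => //; apply: le_lt_trans (ltry (M * (1 - 0))).
  apply: curve_length_lipschitz => u t _ ut _.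
  by apply: (le_trans (gM _ _)); rewrite ger0_norm ?subr_ge0.
pose t (i : nat) : R := i%:R / N%:R.
have Nt i : N%:R * t i = i%:R by rewrite mulrC divfK ?gt_eqF.
have tle i u : (t i <= u) = (i%:R <= N%:R * u) by rewrite ler_pdivrMr// mulrC.
have tge i u : (u <= t i) = (N%:R * u <= i%:R) by rewrite ler_pdivlMr// mulrC.
have gpiece i u : (i < N)%N -> t i <= u <= t i.+1 ->
    gam u = z i + (N%:R * u - i%:R) *: (z i.+1 - z i).
  by move=> iN; rewrite tle tge => H; exact: polygon_piece.
have gdist i u : (i < N)%N -> t i <= u <= t i.+1 ->
    `|gam u - z i| <= r * d (z i).
  move=> iN ui; rewrite (gpiece i u)// addrAC subrr add0r normrZ.
  apply: le_trans (sz i iN); rewrite ler_piMl//.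
  by move: ui; rewrite tle tge -natr1 => /andP[u1 u2]; rewrite ger0_norm ?subr_ge0// lerBlDl.
have dz i : (i < N)%N -> 0 < d (z i).
  by move=> iN; apply: (boundary_dist_gt0 Hdom); apply: Oz; exact: ltnW.
have t0 : t 0%N = 0 by rewrite /t mul0r.
have tN : t N = 1 by rewrite /t divff ?gt_eqF.
have tS i : t i <= t i.+1 by rewrite tle Nt ler_nat.
have g1E : gam 1 = y.
  have iN : (N.-1 < N)%N by rewrite prednK.
  have := gpiece N.-1 1 iN; rewrite (prednK N0) tN lexx andbT tle mulr1 ler_nat.
  rewrite leq_pred => /(_ isT) ->.
  have -> : N%:R - N.-1%:R = 1 :> R.
    by rewrite -{1}(prednK N0) -natr1 addrAC subrr add0r.
  by rewrite scale1r addrC subrK.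
have gO u : 0 <= u <= 1 -> Omega (gam u).
  move=> /andP[u0 u1]; have [->|u1'] := eqVneq u 1.
    by rewrite g1E -zy; exact: Oz.
  have uN : 0 <= N%:R * u by rewrite mulr_ge0.
  have := truncn_itv uN; set i := Num.truncn _ => /andP[i1 i2].
  have iN : (i < N)%N.
    rewrite -(ltr_nat R); apply: le_lt_trans i1 _.
    by rewrite gtr_pMr// lt_neqAle u1'.
  have ui : t i <= u <= t i.+1 by rewrite tle tge i1 ltW.
  apply: (boundary_dist_ball Hdom (Oz i (ltnW iN))).
  by apply: (le_lt_trans (gdist i u iN ui)); rewrite gtr_pMl// dz.
have ti i : (i <= N)%N -> 0 <= t i <= 1.
  by move=> iN; rewrite divr_ge0//= ler_pdivrMr// mul1r ler_nat.
have g0E : gam 0 = x.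
  have := gpiece 0%N 0 N0; rewrite t0 lexx -t0 tS => /(_ isT) ->.
  by rewrite Nt subrr scale0r addr0.
have cin : curve_in Omega x y gam.
  by split => // _ [u + <-]; rewrite /= in_itv; exact: gO.
exists gam; split => //.
apply: (line_integral_le_pieces Hdom rg cin (t := t) (D := fun i => d (z i) * (1 - r))) => //.
  by rewrite divr_ge0 ?subr_ge0// ltW.
move=> i iN; have /andP[ti0 ti1] := ti i (ltnW iN).
have /andP[tS0 tS1] := ti i.+1 iN; have r1' : 0 < 1 - r by rewrite subr_gt0.
split => //.
  split; first by rewrite mulr_gt0// dz.
  have -> : r / (1 - r) * (d (z i) * (1 - r)) = N%:R * (r * d (z i)) * (t i.+1 - t i).
    have dt : N%:R * (t i.+1 - t i) = 1 by rewrite mulrBr !Nt -natr1 addrAC subrr add0r.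
    by rewrite [RHS]mulrAC dt mul1r mulrCA divfK ?gt_eqF// mulrC.
  rewrite -lee_fin -curve_length_fin//.
  apply: curve_length_lipschitz => u w tu uw wt.
  rewrite !(gpiece i)//; last 2 first.
  - by rewrite tu (le_trans uw).
  - by rewrite wt (le_trans tu).
  rewrite opprD addrACA subrr add0r -scalerBl normrZ.
  rewrite opprB addrA subrK -mulrBr ger0_norm ?mulr_ge0 ?subr_ge0//.
  by rewrite [leRHS]mulrAC; apply: ler_wpM2l; rewrite ?sz// mulr_ge0 ?subr_ge0.
move=> u ui; have := gdist i u iN ui.
have := boundary_dist_lip Hdom (z i) (gam u); rewrite distrC; lra.
Qed.

Lemma curve_of_chain (r : R) N x y z : 0 <= r < 1 -> qh_chain Omega r N x y z ->
  exists gam, [/\ rectifiable gam, curve_in Omega x y gam &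
    (line_integral gam invd <= (N%:R * r / (1 - r))%:E)%E].
Proof.
move=> r01 c; rewrite -mulrA; case: N c => [|N] c; last exact: curve_of_chain_pos c.
have [zx zy Oz _] := c.
(* A chain without steps is replaced by one step of size zero, because the
   time of the polygon is rescaled by [N]. *)
have c1 : qh_chain Omega 0 1 x y (fun=> x).
  split => //; first by rewrite -zy -zx.
    by move=> _ _; rewrite -zx; exact: Oz.
  by move=> _ _; rewrite subrr normr0 mul0r.
have [|//|gam [? ? le0]] := curve_of_chain_pos _ _ c1; first by rewrite lexx ltr01.
by exists gam; split => //; move: le0; rewrite mul0r mulr0 mul0r.
Qed.

End quasihyperbolic_chains.

(** * The quasihyperbolic distance through chains *)

Section quasihyperbolic_characterization.
Context {R : realType} {X : completeNormedModType R} (Omega : set X).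
Hypotheses (Hdom : domain Omega) (Hconv : convex_set Omega).
Local Notation d := (boundary_dist Omega).
Local Notation invd := (fun z => (d z)^-1).
Local Notation k := (quasihyperbolic Omega).

Let lengths x y := [set line_integral gam invd
  | gam in [set gam | rectifiable gam /\ curve_in Omega x y gam]].

Let line_integral_ge0 gam : (0 <= line_integral gam invd)%E.
Proof.
apply: integral_ge0 => s _; rewrite lee_fin invr_ge0.
by apply: boundary_dist_ge.
Qed.

Let inf_lengths_ge0 x y : (0 <= ereal_inf (lengths x y))%E.
Proof. by apply: le_ereal_inf_tmp => _ [gam _ <-]. Qed.

Lemma quasihyperbolic_le_chain x y r N z : 0 <= r < 1 ->
  qh_chain Omega r N x y z -> k x y <= N%:R * r / (1 - r).
Proof.
move=> r01 /(curve_of_chain Hdom r01)[gam [rg cg le]].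
have inf_le : (ereal_inf (lengths x y) <= (N%:R * r / (1 - r))%:E)%E.
  by apply: le_trans le; apply: ereal_inf_lbound; exists gam.
have inffin : ereal_inf (lengths x y) \is a fin_num.
  by rewrite ge0_fin_numE//; exact: le_lt_trans inf_le (ltry _).
by rewrite -lee_fin fineK.
Qed.

(** The subdivided segment: by concavity the distance to the boundary is at
    least [m] along it.  This shows that the infimum defining the quasihyperbolic
    distance is finite. *)
Lemma exists_qh_chain x y : Omega x -> Omega y ->
  exists N z, qh_chain Omega 2^-1 N x y z.
Proof.
move=> Ox Oy; pose m := Num.min (d x) (d y).
have m0 : 0 < m by rewrite lt_min !(boundary_dist_gt0 Hdom).
pose N := (Num.truncn (2 * `|y - x| / m)).+1.
have N0 : 0 < N%:R :> R by rewrite ltr0n.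
have Nb : 2 * `|y - x| <= m * N%:R.
  by rewrite [leRHS]mulrC -ler_pdivrMr// ltW// truncnS_gt.
exists N, (fun i => (1 - i%:R / N%:R) *: x + (i%:R / N%:R) *: y).
have i01 i : (i <= N)%N -> 0 <= (i%:R / N%:R : R) <= 1.
  by move=> iN; rewrite divr_ge0//= ler_pdivrMr// mul1r ler_nat.
split.
- by rewrite mul0r subr0 scale1r scale0r addr0.
- by rewrite divff ?gt_eqF// subrr scale0r scale1r add0r.
- by move=> i iN; apply: convex_set_comb => //; exact: i01.
move=> i iN; have s01 := i01 i (ltnW iN).
have := boundary_dist_concave Hdom Hconv Ox Oy s01.
set D := d (_ + _) => Dge.
have mD : m <= D.
  apply: le_trans Dge; have mx : m <= d x by rewrite ge_min lexx.
  have my : m <= d y by rewrite ge_min lexx orbT.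
  move: s01 => /andP[s0 s1]; set s := i%:R / N%:R in s0 s1 *.
  have s1' : 0 <= 1 - s by rewrite subr_ge0.
  have := ler_wpM2l s1' mx; have := ler_wpM2l s0 my; lra.
have -> : (1 - i.+1%:R / N%:R) *: x + (i.+1%:R / N%:R) *: y -
    ((1 - i%:R / N%:R) *: x + (i%:R / N%:R) *: y) = N%:R^-1 *: (y - x).
  have lin (a : R) : (1 - a) *: x + a *: y = x + a *: (y - x).
    by rewrite scalerBl scale1r scalerBr addrAC -addrA.
  rewrite !lin opprD addrACA subrr add0r -scalerBl -natr1 mulrDl div1r.
  by rewrite addrAC subrr add0r.
rewrite normrZ gtr0_norm ?invr_gt0// mulrC ler_pdivrMr//.
have : m * N%:R <= D * N%:R by rewrite ler_wpM2r// ltW.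
rewrite -[2^-1 * D * _]mulrA; lra.
Qed.

(** Together with [quasihyperbolic_le_chain] this determines [k x y] as the
    limit, as [r] goes to [0], of [r] times the least number of steps of a chain
    of ratio [r] from [x] to [y]. *)
Lemma chain_of_quasihyperbolic x y (L : R) : Omega x -> Omega y ->
  k x y < L -> exists2 r0, 0 < r0 & forall r, 0 < r <= r0 ->
    exists N z, N%:R * r <= L /\ qh_chain Omega r N x y z.
Proof.
move=> Ox Oy kL; pose L' := (k x y + L) / 2.
have h2 : 0 <= (2^-1 : R) < 1 by lra.
have [N [z /(curve_of_chain Hdom h2)[gam0 [rg0 cg0 le0]]]] := exists_qh_chain Ox Oy.
have inffin : ereal_inf (lengths x y) \is a fin_num.
  rewrite ge0_fin_numE//; apply: le_lt_trans (ltry _); apply: le_trans le0.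
  by apply: ereal_inf_lbound; exists gam0.
have infL : (ereal_inf (lengths x y) < L'%:E)%E.
  by rewrite -(fineK inffin) lte_fin -/(k x y) /L'; lra.
have [_ [gam [rg cg] <-] gL] := ereal_inf_lt infL.
have L'0 : 0 < L' by rewrite -lte_fin; exact: le_lt_trans gL.
have L'L : L' < L by rewrite /L'; lra.
exists ((L - L') / (L' + 1)); first by apply: divr_gt0; lra.
move=> r /andP[r0]; rewrite ler_pdivlMr; last lra.
move=> rL; have [M [w [Mr c]]] := chain_of_curve Hdom rg cg r0 gL.
exists M, w; split => //; apply: (le_trans Mr); lra.
Qed.

End quasihyperbolic_characterization.

(** * Semiconvexity of the quasihyperbolic distance *)

Section quasihyperbolic_estimates.
Context {R : realType} {X : completeNormedModType R} (Omega : set X).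
Hypotheses (Hdom : domain Omega) (Hconv : convex_set Omega).
Local Notation d := (boundary_dist Omega).
Local Notation k := (quasihyperbolic Omega).

Let short_chain := @chain_of_quasihyperbolic R X Omega Hdom Hconv.
Let le_chain := @quasihyperbolic_le_chain R X Omega Hdom.

Lemma quasihyperbolic_ge0 x y : Omega x -> Omega y -> 0 <= k x y.
Proof.
move=> Ox Oy; rewrite leNgt; apply/negP => k0.
have [|r0 r00 H] := @short_chain x y (k x y / 2) Ox Oy; first lra.
have [N [z [NL _]]] := H r0 ltac:(lra).
have : 0 <= N%:R * r0 by rewrite mulr_ge0// ltW.
lra.
Qed.

Lemma quasihyperbolic_triangle x y w : Omega x -> Omega y -> Omega w ->
  k x w <= k x y + k y w.
Proof.
move=> Ox Oy Ow; have k0 := quasihyperbolic_ge0 Ox Ow.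
apply: (@le_of_small_slack _ _ _ (k x w)) => // e e0.
have [|r1 r10 H1] := @short_chain x y (k x y + e / 2) Ox Oy; first lra.
have [|r2 r20 H2] := @short_chain y w (k y w + e / 2) Oy Ow; first lra.
exists (Num.min (2^-1) (Num.min r1 r2)); first by rewrite !lt_min r10 r20 invr_gt0 ltr0n.
move=> r; rewrite !lt_min => /and4P[r0 rh rr1 rr2].
have [N1 [z1 [N1L c1]]] := H1 r ltac:(lra).
have [N2 [z2 [N2L c2]]] := H2 r ltac:(lra).
have r01 : 0 <= r < 1 by lra.
have := le_chain r01 (qh_chain_cat c1 c2).
rewrite natrD ler_pdivlMr; last lra.
nra.
Qed.

Lemma quasihyperbolic_le_dist x y : Omega x -> Omega y -> 2 * `|y - x| <= d x ->
  k x y <= 2 * `|y - x| / d x.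
Proof.
move=> Ox Oy xy; have dx := boundary_dist_gt0 Hdom Ox.
pose r := `|y - x| / d x.
have r0 : 0 <= r by rewrite divr_ge0// ltW.
have rh : r <= 1 / 2 by rewrite ler_pdivrMr//; lra.
have r01 : 0 <= r < 1 by rewrite r0; lra.
have xyr : `|y - x| <= r * d x by rewrite /r divfK ?gt_eqF.
have := le_chain r01 (qh_chain_segment Ox Oy xyr).
rewrite mul1r => /le_trans; apply.
by rewrite -mulrA -/r ler_pdivrMr; nra.
Qed.

(** The average of the longer chain with the shorter one, extended by standing
    still.  On the first [N1] steps both chains move and the step ratio is [r].
    On the last [N0 - N1] steps only the longer chain moves, and by concavity
    the ratio drops to about [r * (1 - s)], the error being the relative
    variation [eta] of the distance to the boundary along that last part.  Hence
    the length of the average is [N1 + (N0 - N1) * (1 - s)] times [r], which is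
    the convex combination of the two lengths. *)
Lemma quasihyperbolic_conv_chain r N0 N1 x0 y0 x1 y1 z0 z1 s (eta : R) :
  0 <= s <= 1 -> 0 < r -> 2 * r < 1 -> (N1 <= N0)%N -> 0 <= eta <= 1 ->
  (N0 - N1)%:R * r < 1 ->
  d y0 <= d y1 * (1 + eta) * (1 - (N0 - N1)%:R * r) ->
  qh_chain Omega r N0 x0 y0 z0 -> qh_chain Omega r N1 x1 y1 z1 ->
  k ((1 - s) *: x0 + s *: x1) ((1 - s) *: y0 + s *: y1) * (1 - 2 * r) <=
    (1 - s) * (N0%:R * r) + s * (N1%:R * r) +
      s * (1 - s) * ((N0 - N1)%:R * r * eta).
Proof.
move=> s01 r0 r1 N10 eta01 mr1 dy c0 c1.
pose z1' := fun i => z1 (minn i N1).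
have c1' : qh_chain Omega r N0 x1 y1 z1' by apply: qh_chain_stay => //; exact: ltW.
pose z i := (1 - s) *: z0 i + s *: z1' i.
set xs := (_ + _); set ys := (_ + _).
have c : qh_chain Omega r N0 xs ys z by apply: qh_chain_average => //; exact: ltW.
have [zx zy Oz sz] := c.
have [z0x z0y Oz0 sz0] := c0.
have [z1x z1y Oz1 sz1] := c1.
have Oxs : Omega xs by rewrite -zx; exact: Oz.
have Oys : Omega ys by rewrite -zy; exact: Oz.
have Om : Omega (z N1) by exact: Oz.
set m := (N0 - N1)%N in mr1 dy *.
pose r' := r * ((1 - s) * (1 + s * eta)).
have q1 : (1 - s) * (1 + s * eta) <= 2 by move: s01 eta01 => /andP[s0 s1] /andP[e0 e1]; nra.
have q0 : 0 <= (1 - s) * (1 + s * eta).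
  by move: s01 eta01 => /andP[s0 s1] /andP[e0 e1]; rewrite mulr_ge0//; nra.
have r'0 : 0 <= r' by rewrite mulr_ge0// ltW.
have r'2 : r' <= 2 * r by rewrite /r' mulrC ler_pM2r.
have tail : qh_chain Omega r' m (z N1) ys (fun i => z (N1 + i)%N).
  split=> [|||i im]; rewrite ?addn0//.
  - by rewrite /m subnKC.
  - by move=> i im; apply: Oz; rewrite -leq_subRL.
  have iN : (N1 + i < N0)%N by rewrite -ltn_subRL.
  set j := (N1 + i)%N in iN *; rewrite addnS -/j.
  have N1j : (N1 <= j)%N by exact: leq_addr.
  rewrite /z /z1'.
  have -> : minn j.+1 N1 = N1 by apply/minn_idPr/leqW.
  have -> : minn j N1 = N1 by apply/minn_idPr.
  rewrite z1y.
  rewrite opprD addrACA subrr addr0 -scalerBr normrZ ger0_norm; last by move: s01 => /andP[]; lra.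
  have Oj := Oz0 j (ltnW iN).
  have Oy1 : Omega y1 by rewrite -z1y; exact: Oz1.
  have := boundary_dist_concave Hdom Hconv Oj Oy1 s01.
  set D := d (_ + _) => Dge.
  have jm : (N0 - j <= m)%N by rewrite leq_sub2l.
  have jr : (N0 - j)%:R * r <= m%:R * r by rewrite ler_pM2r// ler_nat.
  have := qh_chain_dist Hdom (ltW r0) c0 (leq_subr j N0) ltac:(lra).
  rewrite subKn ?(ltnW iN)// => dj.
  have d0j := boundary_dist_gt0 Hdom Oj.
  have dj' : d (z0 j) <= d y1 * (1 + eta).
    have : d (z0 j) * (1 - m%:R * r) <= d y1 * (1 + eta) * (1 - m%:R * r).
      apply: le_trans dy; apply: le_trans dj; rewrite ler_wpM2l ?(ltW d0j)//; lra.
    by rewrite ler_pM2r//; lra.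
  have sj := sz0 j iN.
  have d1 := boundary_dist_gt0 Hdom Oy1.
  apply: (@le_trans _ _ ((1 - s) * (r * d (z0 j)))).
    by rewrite ler_wpM2l//; move: s01 => /andP[]; lra.
  rewrite /r' -mulrA mulrCA ler_pM2l// -mulrA ler_wpM2l//.
    by move: s01 => /andP[]; lra.
  apply: (@le_trans _ _ ((1 + s * eta) * ((1 - s) * d (z0 j) + s * d y1))).
    move: s01 eta01 => /andP[s0 s1] /andP[e0 e1].
    move: (d (z0 j)) (d y1) d0j d1 dj' => a b a0 b0 ab.
    have : 0 <= s * (eta * ((1 - s) * a + s * b) - (a - b) * (1 - 0)).
      rewrite mulr_ge0// subr0.
      have [ab'|ab'] := lerP a b; first by have := ler_wpM2l e0 (ltW a0); nra.
      have : eta * b <= eta * ((1 - s) * a + s * b) by rewrite ler_wpM2l//; nra.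
      lra.
    lra.
  rewrite ler_wpM2l//; move: s01 eta01 => /andP[s0 s1] /andP[e0 e1]; nra.
have tri := quasihyperbolic_triangle Oxs Om Oys.
have k1 := le_chain (r := r) ltac:(lra) (qh_chain_prefix N10 c).
have k2 := le_chain (r := r') ltac:(lra) tail.
have N10r : N0%:R = N1%:R + m%:R :> R by rewrite -natrD /m subnKC.
have k1' : k xs (z N1) * (1 - 2 * r) <= N1%:R * r.
  move: k1; rewrite ler_pdivlMr; last lra.
  have := quasihyperbolic_ge0 Oxs Om; nra.
have k2' : k (z N1) ys * (1 - 2 * r) <= m%:R * r'.
  move: k2; rewrite ler_pdivlMr; last lra.
  have := quasihyperbolic_ge0 Om Oys; nra.
have : k xs ys * (1 - 2 * r) <= (k xs (z N1) + k (z N1) ys) * (1 - 2 * r).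
  by rewrite ler_pM2r//; lra.
move=> /le_trans; apply; rewrite mulrDl; apply: (le_trans (lerD k1' k2')).
by rewrite N10r /r'; lra.
Qed.

(** In [quasihyperbolic_semiconvex_ineq], [q] bounds the relative difference of
    the distances to the boundary at the two end points, and [mr] is the length
    of the last part of the longer chain. *)
Lemma one_add_le_mul (q a mr : R) : 0 <= q -> q <= 1 / 2 -> a <= 1 / 2 ->
  0 <= mr <= a -> 1 + q <= (1 + (q + 4 * a)) * (1 - mr).
Proof.
move=> q0 q2 a2 /andP[mr0 mra]; have a0 : 0 <= a by exact: le_trans mra.
have p1 : 0 <= a * (3 - q - 4 * a) by rewrite mulr_ge0//; lra.
have p2 : (1 + (q + 4 * a)) * (1 - a) <= (1 + (q + 4 * a)) * (1 - mr).
  by rewrite ler_wpM2l ?lerD2l ?lerN2//; lra.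
by apply: le_trans p2; lra.
Qed.

Lemma quasihyperbolic_lip (delta h : R) x y x' y' : 0 < delta -> 2 * h <= delta ->
  Omega x -> Omega y -> Omega x' -> Omega y' ->
  delta <= d x -> delta <= d y -> delta <= d x' -> delta <= d y' ->
  `|x - x'| <= h -> `|y - y'| <= h -> `|k x y - k x' y'| <= 4 / delta * h.
Proof.
move=> delta0 h2 Ox Oy Ox' Oy' dx dy dx' dy' xx' yy'.
have near u v : Omega u -> Omega v -> delta <= d u -> `|u - v| <= h ->
    k u v <= 2 / delta * h.
  move=> Ou Ov du uv; rewrite distrC in uv.
  have d0 : 0 < d u by lra.
  have := quasihyperbolic_le_dist Ou Ov ltac:(lra).
  move=> /le_trans; apply; rewrite -!mulrA ler_pM2l// (mulrC _ h).
  apply: ler_pM => //; first by rewrite invr_ge0 ltW.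
  by rewrite lef_pV2.
have K2 : 4 / delta * h = 2 / delta * h + 2 / delta * h by field; rewrite gt_eqF.
have xx'' : `|x' - x| <= h by rewrite distrC.
have yy'' : `|y' - y| <= h by rewrite distrC.
have t1 := quasihyperbolic_triangle Ox Ox' Oy; have t2 := quasihyperbolic_triangle Ox' Oy' Oy.
have t3 := quasihyperbolic_triangle Ox' Ox Oy'; have t4 := quasihyperbolic_triangle Ox Oy Oy'.
have n1 := near _ _ Ox Ox' dx xx'; have n2 := near _ _ Oy' Oy dy' yy''.
have n3 := near _ _ Ox' Ox dx' xx''; have n4 := near _ _ Oy Oy' dy yy'.
by rewrite ler_norml; lra.
Qed.

(** With [h] bounding the distance of the two pairs of endpoints, the numbers
    of steps satisfy [(N0 - N1) * r = O(h)], because [k] is Lipschitz, and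
    [eta = E * h] is a legitimate relative variation: the error term of
    [quasihyperbolic_conv_chain] is of order [s * (1 - s) * h ^+ 2]. *)
Lemma quasihyperbolic_semiconvex_ineq (delta h s : R) x0 y0 x1 y1
    (K := 4 / delta) (E := 1 / delta + 4 * (K + 1)) :
  0 < delta -> 0 < h -> 2 * h <= delta -> (K + 1) * h <= 1 / 2 -> E * h <= 1 ->
  Omega x0 -> Omega y0 -> Omega x1 -> Omega y1 ->
  delta <= d x0 -> delta <= d y0 -> delta <= d x1 -> delta <= d y1 ->
  `|x0 - x1| <= h -> `|y0 - y1| <= h -> 0 <= s <= 1 ->
  k ((1 - s) *: x0 + s *: x1) ((1 - s) *: y0 + s *: y1) <=
    (1 - s) * k x0 y0 + s * k x1 y1 + (K + 1) * E * (s * (1 - s) * h ^+ 2).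
Proof.
move=> delta0 h0 h2 Kh Eh Ox0 Oy0 Ox1 Oy1 dx0 dy0 dx1 dy1 xx yy s01.
set ks := k (_ + _) _.
have ks0 : 0 <= ks by apply: quasihyperbolic_ge0; exact: convex_set_comb.
have k00 := quasihyperbolic_ge0 Ox0 Oy0; have k10 := quasihyperbolic_ge0 Ox1 Oy1.
have := quasihyperbolic_lip delta0 h2 Ox0 Oy0 Ox1 Oy1 dx0 dy0 dx1 dy1 xx yy.
rewrite -/K => kk.
have K0 : 0 < K by rewrite divr_gt0.
have i0 : 0 < 1 / delta by rewrite divr_gt0.
have E0 : 0 <= E * h by rewrite mulr_ge0 ?(ltW h0)// /E; lra.
(* [e] is the excess length of the chains over the distances; [r] is then so
   small that the factors [1 - r] and [1 - 2 * r] cost at most a multiple of [e]. *)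
apply/ler_addgt0Pr => e3 e30; pose e := Num.min (e3 / 3) (h / 2).
have e0 : 0 < e by rewrite lt_min !divr_gt0.
have ee : e <= e3 / 3 by rewrite ge_min lexx.
have eh : e <= h / 2 by rewrite ge_min lexx orbT.
have [|r0 r00 H0] := @short_chain x0 y0 (k x0 y0 + e) Ox0 Oy0; first lra.
have [|r1 r10 H1] := @short_chain x1 y1 (k x1 y1 + e) Ox1 Oy1; first lra.
pose M := 1 + k x0 y0 + k x1 y1 + ks; have M0 : 0 < M by rewrite /M; lra.
pose r := Num.min (3^-1) (Num.min (e / M) (Num.min r0 r1)).
have rp : 0 < r by rewrite !lt_min r00 r10 divr_gt0// invr_gt0 ltr0n.
have rh : r <= 3^-1 by rewrite ge_min lexx.
have rM : r * M <= e by rewrite -ler_pdivlMr// !ge_min lexx ?orbT.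
have rr0 : r <= r0 by rewrite !ge_min lexx ?orbT.
have rr1 : r <= r1 by rewrite !ge_min lexx ?orbT.
have [N0 [z0 [N0L c0]]] := H0 r ltac:(lra).
have [N1 [z1 [N1L c1]]] := H1 r ltac:(lra).
have r01 : 0 <= r < 1 by lra.
have rk0 : r * k x0 y0 <= e by apply: le_trans rM; rewrite ler_pM2l// /M; lra.
have rk1 : r * k x1 y1 <= e by apply: le_trans rM; rewrite ler_pM2l// /M; lra.
have rks : r * ks <= e by apply: le_trans rM; rewrite ler_pM2l// /M; lra.
have N0g : k x0 y0 - e <= N0%:R * r.
  have := le_chain r01 c0; rewrite ler_pdivlMr; lra.
have N1g : k x1 y1 - e <= N1%:R * r.
  have := le_chain r01 c1; rewrite ler_pdivlMr; lra.
pose a := (K + 1) * h.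
have dbound u v : `|u - v| <= h -> delta <= d v ->
    forall mr : R, 0 <= mr <= a -> d u <= d v * (1 + E * h) * (1 - mr).
  move=> uv dv mr /andP[mr0 mra].
  have du : d u <= d v + h by have := boundary_dist_lip Hdom u v; lra.
  have dv0 : 0 < d v by lra.
  have hd : h <= d v * (h / delta).
    by rewrite mulrA ler_pdivlMr// mulrC ler_pM2r.
  have hd2 : h / delta <= 1 / 2 by rewrite ler_pdivrMr//; lra.
  have hd0 : 0 <= h / delta by rewrite divr_ge0// ltW.
  have EhE : E * h = h / delta + 4 * a by rewrite /E /a; ring.
  apply: (le_trans du).
  apply: (@le_trans _ _ (d v * (1 + h / delta))); first by lra.
  rewrite -mulrA ler_pM2l// EhE.
  by apply: one_add_le_mul; rewrite ?mr0.
have mrle N M' : M'%:R * r >= N%:R * r - (K * h + 2 * e) -> (M' <= N)%N ->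
    0 <= (N - M')%:R * r <= a.
  move=> H MN; rewrite mulr_ge0 ?(ltW rp)//= natrB// /a; lra.
have fin (N M' : nat) (A B t : R) : (M' <= N)%N -> 0 <= (N - M')%:R * r <= a ->
    N%:R * r <= A + e -> M'%:R * r <= B + e -> 0 <= t <= 1 ->
    ks * (1 - 2 * r) <= (1 - t) * (N%:R * r) + t * (M'%:R * r) +
      t * (1 - t) * ((N - M')%:R * r * (E * h)) ->
    ks <= (1 - t) * A + t * B + (K + 1) * E * (t * (1 - t) * h ^+ 2) + e3.
  move=> MN /andP[m0 ma] NA MB /andP[t0 t1].
  have t10 : 0 <= 1 - t by lra.
  have : t * (1 - t) * ((N - M')%:R * r * (E * h)) <= t * (1 - t) * (a * (E * h)).
    by rewrite ler_wpM2l ?mulr_ge0// ler_wpM2r.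
  have := ler_wpM2l t10 NA; have := ler_wpM2l t0 MB.
  have -> : t * (1 - t) * (a * (E * h)) = (K + 1) * E * (t * (1 - t) * h ^+ 2).
    by rewrite /a; ring.
  lra.
move: kk; rewrite ler_norml => /andP[kk1 kk2].
have r2 : 2 * r < 1 by lra.
have Eh01 : 0 <= E * h <= 1 by rewrite E0 Eh.
have [N10|/ltnW N01] := leqP N1 N0.
- have mr := mrle N0 N1 ltac:(lra) N10.
  apply: (fin N0 N1) => //.
  apply: quasihyperbolic_conv_chain (c0) (c1) => //; first by move: mr; rewrite /a; lra.
  exact: dbound.
- have mr := mrle N1 N0 ltac:(lra) N01.
  have s01' : 0 <= 1 - s <= 1 by lra.
  have sK : 1 - (1 - s) = s by rewrite subKr.
  suff : ks <= (1 - (1 - s)) * k x1 y1 + (1 - s) * k x0 y0 +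
      (K + 1) * E * ((1 - s) * (1 - (1 - s)) * h ^+ 2) + e3.
    by rewrite sK [_ * k x1 y1 + _]addrC (mulrC (1 - s) s).
  have ksE : ks = k ((1 - (1 - s)) *: x1 + (1 - s) *: x0)
                    ((1 - (1 - s)) *: y1 + (1 - s) *: y0).
    by rewrite sK ![s *: _ + _]addrC.
  apply: (fin N1 N0) => //; rewrite ksE.
  apply: quasihyperbolic_conv_chain (c1) (c0) => //; first by move: mr; rewrite /a; lra.
  by apply: dbound => //; rewrite distrC.
Qed.

Lemma quasihyperbolic_locally_semiconvex :
  locally_semiconvex (Omega `*` Omega) (fun q : X * X => k q.1 q.2).
Proof.
move=> [p1 p2] [/= Op1 Op2].
have d1 := boundary_dist_gt0 Hdom Op1; have d2 := boundary_dist_gt0 Hdom Op2.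
pose delta := Num.min (d p1) (d p2) / 2.
have delta0 : 0 < delta by rewrite divr_gt0// lt_min d1 d2.
have delta1 : delta * 2 <= d p1 by rewrite divfK ?pnatr_eq0// ge_min lexx.
have delta2 : delta * 2 <= d p2 by rewrite divfK ?pnatr_eq0// ge_min lexx orbT.
pose K := 4 / delta; pose E := 1 / delta + 4 * (K + 1).
have K0 : 0 < K by rewrite divr_gt0.
have i0 : 0 < 1 / delta by rewrite divr_gt0.
have E0 : 0 < E by rewrite /E; lra.
(* The diameter [2 * rho] of the ball meets the three smallness conditions
   of [quasihyperbolic_semiconvex_ineq]. *)
pose rho := Num.min (delta / 4) (Num.min (1 / 4 / (K + 1)) (1 / 2 / E)).
have rho0 : 0 < rho by rewrite !lt_min; apply/and3P; split; apply: divr_gt0 => //; lra.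
have rho1 : rho <= delta / 4 by rewrite ge_min lexx.
have rho2 : rho * (K + 1) <= 1 / 4.
  by rewrite -ler_pdivlMr ?addr_gt0// !ge_min lexx ?orbT.
have rho3 : rho * E <= 1 / 2 by rewrite -ler_pdivlMr// !ge_min lexx ?orbT.
pose B : set (X * X) := ball (p1, p2) rho.
have BP q : B q -> [/\ `|p1 - q.1| < rho, `|p2 - q.2| < rho, Omega q.1, Omega q.2 &
    delta <= d q.1 /\ delta <= d q.2].
  move=> [/=]; rewrite -!ball_normE /ball_ /= => q1 q2.
  have e1 := boundary_dist_lip Hdom p1 q.1; have e2 := boundary_dist_lip Hdom p2 q.2.
  split => //.
  - by apply: (boundary_dist_ball Hdom Op1); rewrite distrC; lra.
  - by apply: (boundary_dist_ball Hdom Op2); rewrite distrC; lra.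
  - by split; lra.
have Bdist a b : B a -> B b -> [/\ `|a.1 - b.1| <= `|a - b|,
    `|a.2 - b.2| <= `|a - b| & `|a - b| <= 2 * rho].
  move=> /BP[a1 a2 _ _ _] /BP[b1 b2 _ _ _]; rewrite prod_normE /=.
  rewrite !le_max !lexx orbT; split => //.
  have := ler_distD p1 a.1 b.1; have := ler_distD p2 a.2 b.2.
  by rewrite ge_max (distrC a.2 p2) (distrC a.1 p1) => c2 c1; apply/andP; split; lra.
exists B, ((K + 1) * E), K; split.
- exact: ball_open.
- exact: ballxx.
- by split; [apply: mulr_ge0; lra | exact: ltW].
- move=> a b s Ba Bb s01; have [ab1 ab2 ab] := Bdist _ _ Ba Bb.
  have [-> |ab0] := eqVneq a b.
    have -> : (1 - s) *: b + s *: b = b by rewrite -scalerDl subrK scale1r.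
    by rewrite subrr normr0 expr0n /= !mulr0 addr0 -mulrDl subrK mul1r.
  have [_ _ Oa1 Oa2 [da1 da2]] := BP _ Ba; have [_ _ Ob1 Ob2 [db1 db2]] := BP _ Bb.
  have h0 : 0 < `|a - b| by rewrite normr_gt0 subr_eq0.
  apply: (quasihyperbolic_semiconvex_ineq delta0 h0) => //.
  + lra.
  + rewrite -/K; have : (K + 1) * `|a - b| <= (K + 1) * (2 * rho).
      by rewrite ler_wpM2l// addr_ge0// ltW.
    lra.
  + rewrite -/K -/E; have : E * `|a - b| <= E * (2 * rho) by rewrite ler_wpM2l// ltW.
    lra.
- move=> a b Ba Bb; have [ab1 ab2 ab] := Bdist _ _ Ba Bb.
  have [_ _ Oa1 Oa2 [da1 da2]] := BP _ Ba; have [_ _ Ob1 Ob2 [db1 db2]] := BP _ Bb.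
  apply: (quasihyperbolic_lip delta0) => //; lra.
Qed.

End quasihyperbolic_estimates.

(** * Generic differentiability of the quasihyperbolic distance *)

Lemma locally_semiconvex_section (R : realType) (Y Z : normedModType R) (A : set Y) (W : set Z)
    (f : Y * Z -> R) a : A a ->
  locally_semiconvex (A `*` W) f -> locally_semiconvex W (fun z => f (a, z)).
Proof.
move=> Aa H p Wp; have [B [C [K [oB Bp C0K0 cf lf]]]] := H (a, p) (conj Aa Wp).
have dE u v : `|(a, u) - (a, v)| = `|u - v|.
  by rewrite prod_normE /= subrr normr0; apply/max_idPr.
exists [set z | B (a, z)], C, K; split => //.
- apply: open_comp oB => z _; apply: cvg_pair => //=; exact: cvg_cst.
- move=> u v s Bu Bv s01; have := cf _ _ s Bu Bv s01; rewrite dE.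
  rewrite (_ : (1 - s) *: (a, u) + s *: (a, v) = (a, (1 - s) *: u + s *: v))//.
  by congr pair; rewrite -scalerDl subrK scale1r.
- by move=> u v Bu Bv; have := lf _ _ Bu Bv; rewrite dE.
Qed.

Theorem theorem2p4 (R : realType) (X : completeNormedModType R)
    (Omega : set X) (HA : asplund X) (HR : radon_nikodym_property X)
    (Hdom : domain Omega) (Hconv : convex_set Omega) :
  (exists2 D : set (X * X), dense_Gdelta_in (Omega `*` Omega) D &
     forall p, D p ->
       differentiable (fun q : X * X => quasihyperbolic Omega q.1 q.2 : R^o) p)
  /\
  (forall x0 : X, Omega x0 ->
     exists2 D : set X, dense_Gdelta_in Omega D &
       forall y, D y ->
         differentiable (fun z : X => quasihyperbolic Omega x0 z : R^o) y).
Proof.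
have oOmega : open Omega by case: Hdom.
have lsc := quasihyperbolic_locally_semiconvex Hdom Hconv.
split; last first.
  move=> x0 Ox0; have lsc0 := locally_semiconvex_section Ox0 lsc.
  apply: (@generic_frechet R X X X idfun idfun _ Omega HA HA) => //.
  by move=> h; exists h, 0; rewrite /= addr0 normr0.
have linl : linear ((fun x => (x, 0)) : X -> X * X).
  by move=> c u v; congr pair; rewrite /= scaler0 addr0.
have linr : linear ((fun x => (0, x)) : X -> X * X).
  by move=> c u v; congr pair; rewrite /= scaler0 addr0.
pose inl : {linear X -> (X * X)%type} := HB.pack ((fun x => (x, 0)) : X -> X * X)
  (GRing.isLinear.Build R X (X * X)%type *:%R _ linl).
pose inr : {linear X -> (X * X)%type} := HB.pack ((fun x => (0, x)) : X -> X * X)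
  (GRing.isLinear.Build R X (X * X)%type *:%R _ linr).
apply: (@generic_frechet R (X * X)%type X X inl inr _ (Omega `*` Omega) HA HA) => //.
- by move=> x; rewrite prod_normE /= normr0; apply/eqP/eqP; rewrite ge_max lexx normr_ge0.
- by move=> x; rewrite prod_normE /= normr0; apply/eqP/eqP; rewrite ge_max lexx normr_ge0.
- move=> [h1 h2]; exists h1, h2; split.
  + by rewrite /inl /inr /=; congr pair; rewrite /= ?addr0 ?add0r.
  + by rewrite prod_normE /= le_max lexx.
  + by rewrite prod_normE /= le_max lexx orbT.
- by apply: openI; apply: open_comp => // x _; [exact: cvg_fst | exact: cvg_snd].
Qed.
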